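(* Let $\mathcal{O}$ be an operad of graded $R$-modules with an $A_\infty$-multiplication $m\in\mathfrak{s}\mathcal{O}$. Let $\{M_j\}_{j\ge 1}$ be the $A_\infty$-algebra structure on $S\mathfrak{s}\mathcal{O}$ induced by $m$, let $\{\overline{M}_j\}_{j\ge 1}$ be the $A_\infty$-algebra structure on $S\mathfrak{s}\mathrm{End}_{S\mathfrak{s}\mathcal{O}}$ induced by $M=M_1+M_2+\cdots$, and let $\Phi:S\mathfrak{s}\mathcal{O}\to S\mathfrak{s}\mathrm{End}_{S\mathfrak{s}\mathcal{O}}$ be the map $\Phi(Sx)=S\,\overline{\sigma}(\Phi'(x))$ induced by the braces, $\Phi'(x)=\sum_{n\ge 0}b_n(x;-)$ (all defined in the context). Then $\Phi$ is a morphism of $A_\infty$-algebras, i.e. for all $j\geq 1$ $$\Phi\circ M_j=\overline{M}_j\circ \Phi^{\otimes j}.$$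
   Context: $R$ is a commutative ring; graded $R$-modules are cohomologically graded, with the Koszul sign rule. Operads are non-symmetric, $\mathcal{O}=\{\mathcal{O}(n)\}_{n\ge0}$, with partial compositions $\circ_i$ and composition $\gamma$. $\mathrm{End}_A(n)=\mathrm{Hom}(A^{\otimes n},A)$. $S$ is the shift, with $S:A\to SA$ of degree $1$ given by the identity. Operadic suspension: $\Lambda(n)=S^{n-1}R$ with generator $e^n$ in degree $n-1$ and $e^n\circ_i e^m=(-1)^{(n-i)(m-1)}e^{n+m-1}$; $\mathfrak{s}\mathcal{O}(n)=\mathcal{O}(n)\otimes\Lambda(n)$ with diagonal composition $\tilde\gamma$. Identifying $x$ with $x\otimes e^n$, the insertions are $x\tilde\circ_{r+1}y=(-1)^{(n-1)\deg(y)+(n-1)(m-1)+r(m-1)}x\circ_{r+1}y$ for $x\in\mathcal{O}(n)$, $y\in\mathcal{O}(m)$, where $\deg$ is the degree in $\mathcal{O}$ (internal degree). We also write $\mathfrak{s}\mathcal{O}$ for the graded module $\prod_n\mathfrak{s}\mathcal{O}(n)$ with natural degree $|x|=n+\deg(x)-1$ for $x\in\mathfrak{s}\mathcal{O}(n)$ (similarly any operad is identified with the product of its components). Put $x\tilde\circ y=\sum_i x\tilde\circ_i y$. Braces: on any operad, $b_0(x)=x$ and $b_n(x;x_1,\dots,x_n)=\sum\gamma(x;1,\dots,1,x_1,1,\dots,1,x_n,1,\dots,1)$, summed over all order-preserving insertions (zero if $n$ exceeds the arity of $x$), where $\gamma$ is the composition of that operad. Write $b_n$ for the braces on $\mathfrak{s}\mathcal{O}$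 (using $\tilde\gamma$) and $\overline{B}_n$ for those on $\mathfrak{s}\mathrm{End}_{S\mathfrak{s}\mathcal{O}}$. An $A_\infty$-algebra structure on a graded module $A$ is a family $m_j:A^{\otimes j}\to A$, $j\ge1$, of degree $2-j$ with $\sum_{r+q+t=v}(-1)^{rq+t}m_{r+1+t}(1^{\otimes r}\otimes m_q\otimes1^{\otimes t})=0$ for all $v\ge1$. An $A_\infty$-multiplication on $\mathcal{O}$ is a map of operads $\mathcal{A}_\infty\to\mathcal{O}$, equivalently an element $m\in\mathfrak{s}\mathcal{O}$ of natural degree $1$ concentrated in positive arity with $m\tilde\circ m=0$. Structure on $S\mathfrak{s}\mathcal{O}$: set $M'_1(x)=b_1(m;x)-(-1)^{|x|}b_1(x;m)$ and $M'_j(x_1,\dots,x_j)=b_j(m;x_1,\dots,x_j)$ for $j>1$. For $F:B^{\otimes n}\to B$ put $\overline{\sigma}(F)=S\circ F\circ(S^{\otimes n})^{-1}:(SB)^{\otimes n}\to SB$; this gives an operad isomorphism $\overline\sigma:\mathrm{End}_B\cong\mathfrak{s}\mathrm{End}_{SB}$. Then $M_j=\overline\sigma(M'_j)$. Structure on $S\mathfrak{s}\mathrm{End}_{S\mathfrak{s}\mathcal{O}}$: with $M=M_1+M_2+\cdots\in\mathfrak{s}\mathrm{End}_{S\mathfrak{s}\mathcal{O}}$, set $\overline{M}'_1(f)=\overline{B}_1(M;f)-(-1)^{|f|}\overline{B}_1(f;M)$ and $\overline{M}'_j(f_1,\dots,f_j)=\overline{B}_j(M;f_1,\dots,f_j)$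 for $j>1$, and $\overline{M}_j=\overline\sigma(\overline{M}'_j)$. The map $\Phi':\mathfrak{s}\mathcal{O}\to\mathrm{End}_{\mathfrak{s}\mathcal{O}}$ sends $x$ to $\sum_{n\ge0}b_n(x;-)$ (whose arity $n$ component is $b_n(x;-):(\mathfrak{s}\mathcal{O})^{\otimes n}\to\mathfrak{s}\mathcal{O}$), and $\Phi$ is the composite $S\mathfrak{s}\mathcal{O}\xrightarrow{S^{-1}}\mathfrak{s}\mathcal{O}\xrightarrow{\Phi'}\mathrm{End}_{\mathfrak{s}\mathcal{O}}\xrightarrow{\overline\sigma}\mathfrak{s}\mathrm{End}_{S\mathfrak{s}\mathcal{O}}\xrightarrow{S}S\mathfrak{s}\mathrm{End}_{S\mathfrak{s}\mathcal{O}}$. *)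

(* Defs.v *)
(* boolp provides function extensionality and the eqType/choiceType structures
   that lmodType requires on function spaces. *)
From HB Require Import structures.
From mathcomp Require Import all_boot all_order all_algebra.
From mathcomp Require Import boolp.

Set Implicit Arguments.
Unset Strict Implicit.
Unset Printing Implicit Defensive.

Import GRing.Theory.
Local Open Scope ring_scope.

(* Koszul sign (-1)^d for d : int. *)
Definition ksign (R : comPzRingType) (d : int) : R := (-1) ^+ `|d|%N.

(* ------------------------------------------------------------------------ *)
(* Graded modules are given by their homogeneous components. *)

Definition gmod (R : comPzRingType) := int -> lmodType R.

(* A homogeneous element packed with its degree. *)
Definition hel (R : comPzRingType) (A : gmod R) : Type := {d : int & A d}.

Definition mkh (R : comPzRingType) (A : gmod R) (d : int) (x : A d) : hel A :=
  existT (fun e => A e : Type) d x.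

(* Component of degree d of a homogeneous element: a transport when the
   degrees agree, and 0 otherwise. *)
Definition hcomponent (R : comPzRingType) (A : gmod R) (d : int) (u : hel A)
  : A d := untag (T_ := fun e => A e : Type) 0 id u.

(* (SA)^d = A^(d-1); the degree 1 map S : A -> SA and its inverse are the
   identity on underlying elements. *)
Definition shift (R : comPzRingType) (A : gmod R) : gmod R := fun d => A (d - 1).

Definition gmap (R : comPzRingType) (A B : gmod R) :=
  forall d, {linear A d -> B d}.

(* ------------------------------------------------------------------------ *)
Section DependentProduct.
Variables (R : comPzRingType) (F : nat -> lmodType R).

Definition dprod : Type := forall n, F n.

HB.instance Definition _ := gen_eqMixin dprod.
HB.instance Definition _ := gen_choiceMixin dprod.

Definition dprod_zero : dprod := fun=> 0.
Definition dprod_opp (x : dprod) : dprod := fun n => - x n.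
Definition dprod_add (x y : dprod) : dprod := fun n => x n + y n.
Definition dprod_scale (a : R) (x : dprod) : dprod := fun n => a *: x n.

Fact dprod_addA : associative dprod_add.
Proof. by move=> x y z; apply: functional_extensionality_dep => n; apply: addrA. Qed.
Fact dprod_addC : commutative dprod_add.
Proof. by move=> x y; apply: functional_extensionality_dep => n; apply: addrC. Qed.
Fact dprod_add0 : left_id dprod_zero dprod_add.
Proof. by move=> x; apply: functional_extensionality_dep => n; apply: add0r. Qed.
Fact dprod_addN : left_inverse dprod_zero dprod_opp dprod_add.
Proof. by move=> x; apply: functional_extensionality_dep => n; apply: addNr. Qed.

HB.instance Definition _ :=
  GRing.isZmodule.Build dprod dprod_addA dprod_addC dprod_add0 dprod_addN.

Fact dprod_scaleA a b (x : dprod) :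
  dprod_scale a (dprod_scale b x) = dprod_scale (a * b) x.
Proof. by apply: functional_extensionality_dep => n; apply: scalerA. Qed.
Fact dprod_scale1 : left_id 1 dprod_scale.
Proof. by move=> x; apply: functional_extensionality_dep => n; apply: scale1r. Qed.
Fact dprod_scaleDr : right_distributive dprod_scale +%R.
Proof. by move=> a x y; apply: functional_extensionality_dep => n; apply: scalerDr. Qed.
Fact dprod_scaleDl (x : dprod) : {morph dprod_scale^~ x : a b / a + b}.
Proof. by move=> a b; apply: functional_extensionality_dep => n; apply: scalerDl. Qed.

HB.instance Definition _ := GRing.Zmodule_isLmodule.Build R dprod
  dprod_scaleA dprod_scale1 dprod_scaleDr dprod_scaleDl.

End DependentProduct.

(* ------------------------------------------------------------------------ *)
(* Homogeneous multilinear maps: hom n d is the degree d part of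
   Hom(A^{(x)n}, A).  The degree e part of A^{(x)n} is the direct sum, over all
   degree vectors ds of total e, of the tensor products of the A (ds i). *)
Section GradedHom.
Variables (R : comPzRingType) (A : gmod R).

Definition multilinear n d
    (f : forall ds : 'I_n -> int, (forall i, A (ds i)) -> A (d + \sum_i ds i)) :=
  forall ds (xs : forall i, A (ds i)) i, linear (fun u : A (ds i) => f ds (dfwith xs u)).

Record hom n (d : int) := Hom {
  hom_fun :> forall ds : 'I_n -> int, (forall i, A (ds i)) -> A (d + \sum_i ds i);
  homP : multilinear hom_fun }.

Section HomLmod.
Variables (n : nat) (d : int).
Implicit Types f g h : hom n d.

Lemma hom_ext f g : (forall ds xs, f ds xs = g ds xs) -> f = g.
Proof.
case: f g => f fP [g gP] /= fg.
have {}fg : f = g.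
  apply: functional_extensionality_dep => ds.
  by apply: functional_extensionality_dep => xs; apply: fg.
by subst g; congr Hom; apply: Prop_irrelevance.
Qed.

HB.instance Definition _ := gen_eqMixin (hom n d).
HB.instance Definition _ := gen_choiceMixin (hom n d).

Fact hom_zeroP : multilinear (fun (ds : 'I_n -> int) (_ : forall i, A (ds i)) =>
  0 : A (d + \sum_i ds i)).
Proof. by move=> ds xs i a u v; rewrite scaler0 addr0. Qed.
Definition hom_zero := Hom hom_zeroP.

Fact hom_oppP f : multilinear (fun ds xs => - f ds xs).
Proof. by move=> ds xs i a u v; rewrite homP opprD scalerN. Qed.
Definition hom_opp f := Hom (hom_oppP f).

Fact hom_addP f g : multilinear (fun ds xs => f ds xs + g ds xs).
Proof. by move=> ds xs i a u v; rewrite !homP scalerDr addrACA. Qed.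
Definition hom_add f g := Hom (hom_addP f g).

Fact hom_scaleP a f : multilinear (fun ds xs => a *: f ds xs).
Proof. by move=> ds xs i b u v; rewrite homP scalerDr !scalerA mulrC. Qed.
Definition hom_scale a f := Hom (hom_scaleP a f).

Fact hom_addA : associative hom_add.
Proof. by move=> f g h; apply: hom_ext => ds xs; apply: addrA. Qed.
Fact hom_addC : commutative hom_add.
Proof. by move=> f g; apply: hom_ext => ds xs; apply: addrC. Qed.
Fact hom_add0 : left_id hom_zero hom_add.
Proof. by move=> f; apply: hom_ext => ds xs; apply: add0r. Qed.
Fact hom_addN : left_inverse hom_zero hom_opp hom_add.
Proof. by move=> f; apply: hom_ext => ds xs; apply: addNr. Qed.

HB.instance Definition _ :=
  GRing.isZmodule.Build (hom n d) hom_addA hom_addC hom_add0 hom_addN.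

Fact hom_scaleA a b f : hom_scale a (hom_scale b f) = hom_scale (a * b) f.
Proof. by apply: hom_ext => ds xs; apply: scalerA. Qed.
Fact hom_scale1 : left_id 1 hom_scale.
Proof. by move=> f; apply: hom_ext => ds xs; apply: scale1r. Qed.
Fact hom_scaleDr : right_distributive hom_scale +%R.
Proof. by move=> a f g; apply: hom_ext => ds xs; apply: scalerDr. Qed.
Fact hom_scaleDl f : {morph hom_scale^~ f : a b / a + b}.
Proof. by move=> a b; apply: hom_ext => ds xs; apply: scalerDl. Qed.

HB.instance Definition _ := GRing.Zmodule_isLmodule.Build R (hom n d)
  hom_scaleA hom_scale1 hom_scaleDr hom_scaleDl.

End HomLmod.
End GradedHom.

(* ------------------------------------------------------------------------ *)
(* Non-symmetric graded operads through partial compositions.  Positions are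
   numbered from 0, so that [ocomp x i y] is x o_{i+1} y. *)

Record operad_data (R : comPzRingType) := OperadData {
  op :> nat -> int -> lmodType R;
  ounit : op 1 0;
  ocomp : forall n m (p q : int), op n p -> 'I_n -> op m q -> op (n + m).-1 (p + q);
  ocomp_linl : forall n m p q (i : 'I_n) (y : op m q),
    linear (fun x : op n p => ocomp x i y);
  ocomp_linr : forall n m p q (x : op n p) (i : 'I_n),
    linear (fun y : op m q => ocomp x i y) }.

Section Cells.
Variables (R : comPzRingType) (P : operad_data R).

(* A homogeneous element packed with its arity and degree. *)
Definition cell : Type := {nd : nat * int & P nd.1 nd.2}.

Definition mkc n d (x : P n d) : cell :=
  existT (fun nd : nat * int => P nd.1 nd.2 : Type) (n, d) x.

Definition arity (c : cell) : nat := (tag c).1.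

Definition component n d (c : cell) : P n d :=
  untag (T_ := fun nd : nat * int => P nd.1 nd.2 : Type) (i := (n, d)) 0 id c.

End Cells.

(* The axioms are equations between packed elements because both sides have
   arities and degrees that are equal only propositionally. *)
Definition operad_axioms (R : comPzRingType) (P : operad_data R) : Prop :=
  [/\ forall n m l p q r (x : P n p) (y : P m q) (z : P l r)
        (i : 'I_n) (j : 'I_m) (k : 'I_(n + m).-1), k = (i + j)%N :> nat ->
        mkc (ocomp (ocomp x i y) k z) = mkc (ocomp x i (ocomp y j z)),
      forall n m l p q r (x : P n p) (y : P m q) (z : P l r)
        (i k : 'I_n) (i' : 'I_(n + l).-1) (k' : 'I_(n + m).-1),
        (i < k)%N -> i' = i :> nat -> k' = (k + m).-1 :> nat ->
        mkc (ocomp (ocomp x i y) k' z) =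
        mkc (ksign R (q * r) *: ocomp (ocomp x k z) i' y),
      forall n p (x : P n p), mkc (ocomp (ounit P) ord0 x) = mkc x
    & forall n p (x : P n p) (i : 'I_n), mkc (ocomp x i (ounit P)) = mkc x].

Record operad (R : comPzRingType) := Operad {
  odata :> operad_data R;
  operadP : operad_axioms odata }.

(* ------------------------------------------------------------------------ *)
(* Linear dependence of packed elements whose index does not vary. *)
Section TaggedLinear.
Variables (R : comPzRingType) (V : lmodType R).

Definition tlinear (I : eqType) (F : I -> lmodType R) (G : V -> {i : I & F i}) :=
  exists i (phi : V -> F i),
    linear phi /\ forall u, G u = existT (fun j => F j : Type) i (phi u).

Lemma tlinear_ext (I : eqType) (F : I -> lmodType R) (G H : V -> {i : I & F i}) :
  (forall u, G u = H u) -> tlinear G -> tlinear H.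
Proof. by move=> GH [e [phi [lphi GE]]]; exists e, phi; split=> // u; rewrite -GH. Qed.

Lemma untag_linear (I : eqType) (F : I -> lmodType R) (G : V -> {i : I & F i}) i :
  tlinear G -> linear (fun u => untag (T_ := fun j => F j : Type) (i := i) 0 id (G u)).
Proof.
case=> j [phi [lphi GE]] a u v; rewrite !GE.
have [ji|ji] := eqVneq j i; last by rewrite !untag_dflt // scaler0 addr0.
by case: _ / ji; rewrite !(untagE _ _ (erefl : tag (existT _ j _) = j)); apply: lphi.
Qed.

Lemma hcomponent_linear (A : gmod R) (G : V -> hel A) d :
  tlinear (F := A) G -> linear (fun u => hcomponent d (G u)).
Proof. exact: (@untag_linear _ A). Qed.

Lemma component_linear (P : operad_data R) (G : V -> cell P) n d :
  tlinear (F := fun nd => P nd.1 nd.2) G -> linear (fun u => component n d (G u)).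
Proof. by move=> lG; apply: (untag_linear (n, d) lG). Qed.

Lemma linear_sum_fun (W : lmodType R) (J : Type) (r : seq J) (Q : pred J)
    (f : J -> V -> W) :
  (forall j, linear (f j)) -> linear (fun u => \sum_(j <- r | Q j) f j u).
Proof.
move=> lf a u v; rewrite scaler_sumr -big_split /=.
by apply: eq_bigr => j _; apply: lf.
Qed.

Lemma linear_scale_fun (W : lmodType R) (c : R) (f : V -> W) :
  linear f -> linear (fun u => c *: f u).
Proof. by move=> lf a u v; rewrite lf scalerDr !scalerA mulrC. Qed.

End TaggedLinear.

Lemma map_enum_ord_split (T : Type) n (h h' : 'I_n -> T) (i : 'I_n) :
  (forall j, i != j -> h' j = h j) ->
  [seq h' j | j <- enum 'I_n] =
    take i [seq h j | j <- enum 'I_n] ++ h' i :: drop i.+1 [seq h j | j <- enum 'I_n].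
Proof.
move=> hh'; set s := [seq h j | j <- enum 'I_n].
have sz : size s = n by rewrite size_map size_enum_ord.
apply: (@eq_from_nth _ (h i)) => [|j].
  rewrite size_map size_enum_ord size_cat /= size_take size_drop sz ltn_ord.
  by rewrite addnS -addSn subnKC.
rewrite size_map size_enum_ord => jn; pose j' := Ordinal jn.
have nthE (g : 'I_n -> T) : nth (h i) [seq g k | k <- enum 'I_n] j = g j'.
  rewrite (nth_map j') ?size_enum_ord //.
  by rewrite (_ : nth j' _ _ = j') //; apply: val_inj; rewrite /= nth_enum_ord.
rewrite nthE nth_cat size_take sz ltn_ord; case: (ltngtP j i) => [ji|ij|ji].
- rewrite nth_take // nthE hh' //.
  by apply/eqP => ij; move: ji; rewrite ij /= ltnn.
- rewrite -subSS subSn // /= nth_drop subnKC // nthE hh' //.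
  by apply/eqP => e; move: ij; rewrite e /= ltnn.
- by rewrite ji subnn /=; congr h'; apply: val_inj.
Qed.

(* ------------------------------------------------------------------------ *)
Section Endomorphisms.
Variables (R : comPzRingType) (A : gmod R).

(* Value of f on a list of homogeneous elements, expected of length n. *)
Definition hom_app n d (f : hom A n d) (s : seq (hel A)) : hel A :=
  mkh (f (fun j => tag (nth (mkh (0 : A 0)) s j))
         (fun j => tagged (nth (mkh (0 : A 0)) s j))).

Definition hels n (ds : 'I_n -> int) (xs : forall i, A (ds i)) : seq (hel A) :=
  [seq mkh (xs i) | i <- enum 'I_n].

(* f (1^{(x)i} (x) g (x) 1^{(x)(n-1-i)}); the sign comes from moving g past the
   first i arguments. *)
Definition end_comp_fun n m p q (f : hom A n p) (i : 'I_n) (g : hom A m q)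
    (ds : 'I_(n + m).-1 -> int) (xs : forall l, A (ds l))
    : A (p + q + \sum_l ds l) :=
  let s := hels xs in
  ksign R (q * \sum_(l : 'I_(n + m).-1 | (l < i)%N) ds l) *:
  hcomponent (p + q + \sum_l ds l)
    (hom_app f (take i s ++ hom_app g (take m (drop i s)) :: drop (i + m) s)).

Lemma ecast_linear e e' (E : e = e') : linear (fun x : A e => ecast d (A d) E x).
Proof. by case: _ / E. Qed.

Lemma mkh_ecast e e' (E : e = e') (x : A e) : mkh (ecast d (A d) E x) = mkh x.
Proof. by case: _ / E. Qed.

Lemma hom_app_tlinear (V : lmodType R) n d (f : hom A n d) (s1 s2 : seq (hel A))
    (G : V -> hel A) : (size s1 < n)%N -> tlinear (F := A) G ->
  tlinear (F := A) (fun u => hom_app f (s1 ++ G u :: s2)).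
Proof.
move=> s1n [e [phi [lphi GE]]].
pose h u (j : 'I_n) := nth (mkh (0 : A 0)) (s1 ++ G u :: s2) j.
pose i0 := Ordinal s1n.
have hi0 u : h u i0 = mkh (phi u) by rewrite /h nth_cat ltnn subnn /= GE.
have hj u j : i0 != j -> h u j = h 0 j.
  move=> nj; rewrite /h !nth_cat; case: ltnP => // s1j.
  have : (size s1 < j)%N by rewrite ltn_neqAle s1j andbT.
  by rewrite -subn_gt0; case: (j - size s1)%N.
pose ds0 j := tag (h 0 j).
have E : e = ds0 i0 by rewrite /ds0 hi0.
pose xs0 j : A (ds0 j) := tagged (h 0 j).
pose phi' u : A (ds0 i0) := ecast d (A d) E (phi u).
have lphi' : linear phi'.
  by move=> a u v; rewrite /phi' lphi ecast_linear.
have hE u : h u = fun j => mkh (dfwith xs0 (phi' u) j).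
  apply: functional_extensionality_dep => j.
  case: dfwithP => [|k nk].
    by rewrite hi0 /phi' mkh_ecast.
  by rewrite hj // /xs0 /ds0; case: (h 0 k).
exists (d + \sum_i ds0 i), (fun u => f ds0 (dfwith xs0 (phi' u))); split.
  by move=> a u v; rewrite lphi' homP.
move=> u; pose K (y : 'I_n -> hel A) :=
  mkh (f (fun j => tag (y j)) (fun j => tagged (y j))).
by rewrite -[LHS]/(K (h u)) hE.
Qed.

Lemma hom_app_linl n d (s : seq (hel A)) :
  tlinear (F := A) (fun f : hom A n d => hom_app f s).
Proof. by do 2!eexists; split=> [|f]; last by []; move=> a f g. Qed.

Lemma helsE n (ds : 'I_n -> int) (xs : forall i, A (ds i)) (i : 'I_n) (u : A (ds i)) :
  hels (dfwith xs u) = take i (hels xs) ++ mkh u :: drop i.+1 (hels xs).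
Proof.
rewrite /hels (@map_enum_ord_split _ _ (fun j => mkh (xs j)) _ i) ?dfwith_in // => j ij.
by rewrite dfwith_out.
Qed.

Lemma take_mid (T : Type) (a b : seq T) x i : (size a < i)%N ->
  take i (a ++ x :: b) = a ++ x :: take (i - (size a).+1) b.
Proof.
move=> ai; rewrite take_cat ltnNge (ltnW ai) /=.
by rewrite -[(i - size a)%N]prednK ?subn_gt0 // -subnS.
Qed.

Lemma drop_mid (T : Type) (a b : seq T) x i : (size a < i)%N ->
  drop i (a ++ x :: b) = drop (i - (size a).+1) b.
Proof.
move=> ai; rewrite drop_cat ltnNge (ltnW ai) /=.
by rewrite -[(i - size a)%N]prednK ?subn_gt0 // -subnS.
Qed.

Lemma drop_pre (T : Type) (a b : seq T) i : (i <= size a)%N ->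
  drop i (a ++ b) = drop i a ++ b.
Proof.
rewrite drop_cat leq_eqVlt => /orP[/eqP->|->] //.
by rewrite ltnn subnn drop0 drop_size.
Qed.

Fact end_compP n m p q (f : hom A n p) (i : 'I_n) (g : hom A m q) :
  multilinear (end_comp_fun f i g).
Proof.
move=> ds xs l; rewrite /end_comp_fun; apply: linear_scale_fun.
apply: hcomponent_linear.
have sz : size (hels xs) = (n + m).-1 by rewrite size_map size_enum_ord.
have ltl := ltn_ord l; have lti := ltn_ord i.
have mkl : tlinear (F := A) (fun u : A (ds l) => mkh u) by exists (ds l), id.
set a := take l (hels xs); set b := drop l.+1 (hels xs).
have sa : size a = l by rewrite size_take sz ltl.
have [li|il] := ltnP l i.
  apply: (@tlinear_ext _ _ _ A (fun u => hom_app f (a ++ mkh u ::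
    (take (i - l.+1) b ++ hom_app g (take m (drop (i - l.+1) b))
       :: drop (i + m - l.+1) b)))); last first.
    by apply: hom_app_tlinear => //; rewrite sa (ltn_trans li).
  move=> u; rewrite helsE -/a -/b take_mid ?drop_mid ?sa -?catA //.
  exact: ltn_addr.
have [lim|iml] := ltnP l (i + m).
  apply: (@tlinear_ext _ _ _ A (fun u => hom_app f (take i a ++
    hom_app g (drop i a ++ mkh u :: take (m - (l - i).+1) b)
      :: drop (i + m - l.+1) b))); last first.
    apply: hom_app_tlinear; first by rewrite size_takel ?sa.
    by apply: hom_app_tlinear => //; rewrite size_drop sa ltn_subLR.
  move=> u; rewrite helsE -/a -/b takel_cat ?sa // drop_pre ?sa //.
  by rewrite take_mid size_drop sa ?ltn_subLR // drop_mid sa.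
apply: (@tlinear_ext _ _ _ A (fun u => hom_app f ((take i a ++
    hom_app g (take m (drop i a)) :: drop (i + m) a) ++ mkh u :: b))); last first.
  apply: hom_app_tlinear => //.
  rewrite size_cat /= size_takel ?sa // size_drop sa.
  rewrite addnS -addSn -(ltn_add2r m) -addnA addSn.
  have -> : (i + (l - (i + m) + m))%N = l by rewrite addnCA subnK.
  by move: (nat_of_ord l) ltl => k; case: (n + m)%N.
move=> u; rewrite helsE -/a -/b takel_cat ?sa // drop_pre ?sa //.
rewrite takel_cat ?size_drop ?sa ?leq_subRL // drop_pre ?sa //.
by rewrite -catA.
Qed.

Definition end_comp n m p q (f : hom A n p) (i : 'I_n) (g : hom A m q) :
  hom A (n + m).-1 (p + q) := Hom (end_compP f i g).

Fact end_comp_linl n m p q (i : 'I_n) (g : hom A m q) :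
  linear (fun f : hom A n p => end_comp f i g).
Proof.
move=> a f f'; apply: hom_ext => ds xs.
suff lF : linear (fun f : hom A n p => end_comp_fun f i g xs) by exact: lF.
by apply: linear_scale_fun; apply: hcomponent_linear; apply: hom_app_linl.
Qed.

Fact end_comp_linr n m p q (f : hom A n p) (i : 'I_n) :
  linear (fun g : hom A m q => end_comp f i g).
Proof.
move=> a g g'; apply: hom_ext => ds xs.
suff lF : linear (fun g : hom A m q => end_comp_fun f i g xs) by exact: lF.
apply: linear_scale_fun; apply: hcomponent_linear.
apply: hom_app_tlinear; last exact: hom_app_linl.
by rewrite size_take_min (leq_ltn_trans (geq_minl _ _)).
Qed.

Definition end_unit_fun (ds : 'I_1 -> int) (xs : forall i, A (ds i))
  : A (0 + \sum_i ds i) := hcomponent _ (mkh (xs ord0)).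

Fact end_unitP : multilinear end_unit_fun.
Proof.
move=> ds xs i; rewrite /end_unit_fun; apply: hcomponent_linear.
exists (ds ord0), (fun u => dfwith xs u ord0); split=> // a u v.
by move: u v; rewrite (ord1 i) => u v; rewrite !dfwith_in.
Qed.

Definition End_operad : operad_data R := {|
  op := fun n d => hom A n d;
  ounit := Hom end_unitP;
  ocomp := end_comp;
  ocomp_linl := end_comp_linl;
  ocomp_linr := end_comp_linr |}.

End Endomorphisms.

(* ------------------------------------------------------------------------ *)
(* Operadic suspension, graded by natural degree: the summand of natural degree
   e in arity n is O(n)^(e+1-n) (x) e^n, with x (x) e^n identified with x. *)
Section Suspension.
Variables (R : comPzRingType) (O : operad_data R).

Definition susp_op (n : nat) (e : int) : lmodType R := O n (e + 1 - n%:Z).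

(* The degree deg(y) in O of y : susp_op m q is q + 1 - m. *)
Definition susp_comp n m p q (x : susp_op n p) (i : 'I_n) (y : susp_op m q)
    : susp_op (n + m).-1 (p + q) :=
  ksign R ((n%:Z - 1) * (q + 1 - m%:Z) + (n%:Z - 1) * (m%:Z - 1) + i%:Z * (m%:Z - 1)) *:
  hcomponent (A := O (n + m).-1) (p + q + 1 - (n + m).-1%:Z) (mkh (ocomp x i y)).

Fact susp_comp_linl n m p q (i : 'I_n) (y : susp_op m q) :
  linear (fun x : susp_op n p => susp_comp x i y).
Proof.
apply: linear_scale_fun; apply: (hcomponent_linear (A := O (n + m).-1)).
by do 2!eexists; split; last by []; apply: ocomp_linl.
Qed.

Fact susp_comp_linr n m p q (x : susp_op n p) (i : 'I_n) :
  linear (fun y : susp_op m q => susp_comp x i y).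
Proof.
apply: linear_scale_fun; apply: (hcomponent_linear (A := O (n + m).-1)).
by do 2!eexists; split; last by []; apply: ocomp_linr.
Qed.

Definition susp : operad_data R := {|
  op := susp_op;
  ounit := ounit O;
  ocomp := susp_comp;
  ocomp_linl := susp_comp_linl;
  ocomp_linr := susp_comp_linr |}.

End Suspension.

(* ------------------------------------------------------------------------ *)
Section Braces.
Variables (R : comPzRingType) (P : operad_data R).

Definition prodg : gmod R := fun d => dprod (fun n => P n d).

(* x o y = sum_i x o_i y, extended to products. *)
Definition circ p q (x : prodg p) (y : prodg q) : prodg (p + q) := fun N =>
  \sum_(k < N.+2) \sum_(l < N.+2 | (k + l == N.+1)%N) \sum_(i < k)
    component N (p + q) (mkc (ocomp (x k) i (y l))).

(* Only used with i smaller than the arity of c. *)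
Definition cell_comp (c : cell P) (i : nat) (y : cell P) : cell P :=
  if insub i is Some j then mkc (ocomp (tagged c) (j : 'I_(arity c)) (tagged y))
  else mkc (0 : P 0 0).

(* gamma (c; y_1, ..., y_k), composing from left to right: the next free input
   after y_1, ..., y_j is shifted by the arities already inserted, and no Koszul
   sign appears in this order. *)
Fixpoint gamma_from (i : nat) (c : cell P) (ys : seq (cell P)) : cell P :=
  if ys is y :: ys' then gamma_from (i + arity y) (cell_comp c i y) ys' else c.

Definition gamma := gamma_from 0.

(* All sequences of length k obtained from ys by inserting operadic units,
   keeping the order; there are none if size ys > k. *)
Fixpoint insertions (k : nat) (ys : seq (cell P)) : seq (seq (cell P)) :=
  match k, ys with
  | 0, [::] => [:: [::]]
  | 0, _ :: _ => [::]
  | k'.+1, [::] => [seq mkc (ounit P) :: s | s <- insertions k' [::]]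
  | k'.+1, y :: ys' => [seq mkc (ounit P) :: s | s <- insertions k' ys]
                       ++ [seq y :: s | s <- insertions k' ys']
  end.

Definition brace_cell N D (c : cell P) (ys : seq (cell P)) : P N D :=
  \sum_(s <- insertions (arity c) ys) component N D (gamma c s).

(* b_n (x; xs) on the product.  Components of arities k and l i contribute in
   arity k + sum_i (l i - 1), so every component is a finite sum. *)
Definition brace n d (x : prodg d) (ds : 'I_n -> int) (xs : forall i, prodg (ds i))
    : prodg (d + \sum_i ds i) := fun N =>
  \sum_(k < (N + n).+1)
    \sum_(l : {ffun 'I_n -> 'I_(N + n).+1} | (k + \sum_i l i == N + n)%N)
      brace_cell N (d + \sum_i ds i) (mkc (x k)) [seq mkc (xs i (l i)) | i <- enum 'I_n].

(* The components selected in brace are those in which gamma takes its values. *)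
Lemma gamma_from_tag i c ys : arity c = (i + size ys)%N ->
  tag (gamma_from i c ys) =
    ((i + \sum_(y <- ys) arity y)%N, (tag c).2 + \sum_(y <- ys) (tag y).2).
Proof.
elim: ys i c => [|y ys IH] i c /= ac.
  by rewrite !big_nil addr0 addn0 -[i]addn0 -ac /arity; case: (tag c).
have ic : (i < arity c)%N by rewrite ac addnS ltnS leq_addr.
rewrite !big_cons addnA addrA IH /cell_comp insubT //=.
by rewrite /arity /= -/(arity c) -/(arity y) ac addnS addSn /= addnAC.
Qed.

Lemma insertions_all k ys :
  all (fun s => [&& size s == k,
    (\sum_(y <- s) arity y + size ys == k + \sum_(y <- ys) arity y)%N &
    \sum_(y <- s) (tag y).2 == \sum_(y <- ys) (tag y).2]) (insertions k ys).
Proof.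
elim: k ys => [|k IH] [|y ys] //=; first by rewrite !big_nil !eqxx.
  rewrite all_map; apply: sub_all (IH [::]) => s /and3P[/eqP sk /eqP as_ /eqP ds].
  by rewrite /= sk big_cons -addnA as_ big_cons ds add0r !big_nil !eqxx.
rewrite all_cat !all_map; apply/andP; split.
  apply: sub_all (IH (y :: ys)) => s /and3P[/eqP sk /eqP as_ /eqP ds].
  by rewrite /= sk ![\sum_(_ <- _ :: s) _]big_cons -addnA as_ ds add0r !eqxx.
apply: sub_all (IH ys) => s /and3P[/eqP sk /eqP as_ /eqP ds].
by rewrite /= sk !big_cons ds !eqxx andbT /= addnS -addnA as_ addnCA addSn.
Qed.

Local Notation F := (fun nd : nat * int => P nd.1 nd.2).

Lemma cell_comp_tlinearl (V : lmodType R) (G : V -> cell P) i y :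
  tlinear (F := F) G -> tlinear (F := F) (fun u => cell_comp (G u) i y).
Proof.
case=> -[n d] [phi [lphi GE]].
apply: (@tlinear_ext _ _ _ F (fun u => cell_comp (mkc (phi u)) i y)).
  by move=> u; rewrite GE.
rewrite /cell_comp /arity /=; case: insub => [j|].
  exists ((n + (tag y).1).-1, d + (tag y).2), (fun u => ocomp (phi u) j (tagged y)).
  by split=> // a u v; rewrite lphi ocomp_linl.
exists (0%N, 0), (fun=> 0); split=> // a u v.
by rewrite scaler0 addr0.
Qed.

Lemma cell_comp_tlinearr (V : lmodType R) (G : V -> cell P) c i :
  tlinear (F := F) G -> tlinear (F := F) (fun u => cell_comp c i (G u)).
Proof.
case=> -[n d] [phi [lphi GE]].
apply: (@tlinear_ext _ _ _ F (fun u => cell_comp c i (mkc (phi u)))).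
  by move=> u; rewrite GE.
rewrite /cell_comp; case: insub => [j|].
  exists (((tag c).1 + n).-1, (tag c).2 + d), (fun u => ocomp (tagged c) j (phi u)).
  by split=> // a u v; rewrite lphi ocomp_linr.
exists (0%N, 0), (fun=> 0); split=> // a u v.
by rewrite scaler0 addr0.
Qed.

Lemma gamma_from_tlinearl (V : lmodType R) (G : V -> cell P) i ys :
  tlinear (F := F) G -> tlinear (F := F) (fun u => gamma_from i (G u) ys).
Proof.
elim: ys i G => //= y ys IH i G lG.
by apply: (IH _ (fun u => cell_comp (G u) i y)); apply: cell_comp_tlinearl.
Qed.

Lemma gamma_from_tlinearr (V : lmodType R) (G : V -> cell P) i c s1 s2 :
  tlinear (F := F) G -> tlinear (F := F) (fun u => gamma_from i c (s1 ++ G u :: s2)).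
Proof.
move=> lG; elim: s1 i c => [|y s1 IH] i c /=; last exact: IH.
have [[n d] [phi [_ GE]]] := lG.
apply: (@tlinear_ext _ _ _ F (fun u => gamma_from (i + n) (cell_comp c i (G u)) s2)).
  by move=> u; rewrite GE.
by apply: gamma_from_tlinearl; apply: cell_comp_tlinearr.
Qed.

Lemma linear0_fun (V W : lmodType R) : linear (fun _ : V => 0 : W).
Proof. by move=> a u v; rewrite scaler0 addr0. Qed.

Lemma linear_add_fun (V W : lmodType R) (f g : V -> W) :
  linear f -> linear g -> linear (fun u => f u + g u).
Proof. by move=> lf lg a u v; rewrite lf lg scalerDr addrACA. Qed.

Lemma linear_ext (V W : lmodType R) (f g : V -> W) :
  (forall u, f u = g u) -> linear f -> linear g.
Proof. by move=> fg lf a u v; rewrite -!fg lf. Qed.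

Lemma sum_insertions_linear (V W : lmodType R) (G : V -> cell P) k s1 s2
    (H : seq (cell P) -> W) :
  (forall t1 t2, linear (fun u => H (t1 ++ G u :: t2))) ->
  linear (fun u => \sum_(s <- insertions k (s1 ++ G u :: s2)) H s).
Proof.
elim: k s1 H => [|k IH] s1 H lH.
  by apply: linear_ext (@linear0_fun _ _) => u; case: s1 => [|? ?] /=; rewrite big_nil.
case: s1 => [|y s1].
  apply: (@linear_ext _ _ (fun u =>
      \sum_(s <- insertions k ([::] ++ G u :: s2)) H (mkc (ounit P) :: s) +
      \sum_(s <- insertions k s2) H (G u :: s))).
    by move=> u; rewrite /= big_cat !big_map.
  apply: linear_add_fun.
    by apply: IH => t1 t2; apply: (lH (_ :: t1)).
  by apply: linear_sum_fun => s; apply: (lH [::]).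
apply: (@linear_ext _ _ (fun u =>
    \sum_(s <- insertions k ((y :: s1) ++ G u :: s2)) H (mkc (ounit P) :: s) +
    \sum_(s <- insertions k (s1 ++ G u :: s2)) H (y :: s))).
  by move=> u; rewrite /= big_cat !big_map.
apply: linear_add_fun.
  by apply: (IH (y :: s1)) => t1 t2; apply: (lH (_ :: t1)).
by apply: IH => t1 t2; apply: (lH (_ :: t1)).
Qed.

Lemma brace_linearl n d (ds : 'I_n -> int) (xs : forall i, prodg (ds i)) :
  linear (fun x : prodg d => brace x xs).
Proof.
move=> a x y; apply: functional_extensionality_dep => N.
suff lB : linear (fun x : prodg d => brace x xs N) by exact: lB.
apply: linear_sum_fun => k; apply: linear_sum_fun => l.
apply: linear_sum_fun => s; apply: component_linear.
apply: gamma_from_tlinearl.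
by exists (k : nat, d), (fun x : prodg d => x k).
Qed.

Fact braceP n d (x : prodg d) : multilinear (@brace n d x).
Proof.
move=> ds xs i a u v; apply: functional_extensionality_dep => N.
suff lB : linear (fun u : prodg (ds i) => brace x (dfwith xs u) N) by exact: lB.
rewrite /brace; apply: linear_sum_fun => k; apply: linear_sum_fun => l.
apply: (@linear_ext _ _ (fun u : prodg (ds i) =>
  \sum_(s <- insertions k (take i [seq mkc (xs j (l j)) | j <- enum 'I_n] ++
     mkc (u (l i)) :: drop i.+1 [seq mkc (xs j (l j)) | j <- enum 'I_n]))
    component N (d + \sum_i ds i) (gamma (mkc (x k)) s))).
  move=> w; rewrite /brace_cell.
  rewrite (@map_enum_ord_split _ _ (fun j => mkc (xs j (l j)))
    (fun j => mkc (dfwith xs w j (l j))) i) ?dfwith_in //.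
  by move=> j ij; rewrite dfwith_out.
apply: (sum_insertions_linear (G := fun u : prodg (ds i) => mkc (u (l i)))) => t1 t2.
apply: component_linear; apply: gamma_from_tlinearr.
by exists (l i : nat, ds i), (fun u : prodg (ds i) => u (l i)).
Qed.

Definition brace_hom n d (x : prodg d) : hom prodg n d := Hom (@braceP n d x).

Section InducedStructure.
Variable m : prodg 1.

Definition bracket_fun (ds : 'I_1 -> int) (xs : forall i, prodg (ds i))
    : prodg (1 + \sum_i ds i) :=
  brace m xs - ksign R (ds ord0) *:
    hcomponent (1 + \sum_i ds i) (mkh (brace (xs ord0) (fun _ : 'I_1 => m))).

Fact bracketP : multilinear bracket_fun.
Proof.
move=> ds xs i.
apply: linear_add_fun; first exact: (braceP m xs).
apply: (@linear_ext _ _ (fun u : prodg (ds i) => - ksign R (ds ord0) *: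
    hcomponent (1 + \sum_i ds i) (mkh (brace (dfwith xs u ord0) (fun _ : 'I_1 => m))))).
  by move=> u; rewrite scaleNr.
apply: linear_scale_fun; apply: hcomponent_linear.
do 2!eexists; split; last by [].
move: i; move=> i; rewrite (ord1 i) => a u v.
by rewrite !dfwith_in brace_linearl.
Qed.

(* M'_1 (x) = b_1 (m; x) - (-1)^|x| b_1 (x; m) and M'_j = b_j (m; -) for j > 1.
   The value at j = 0 is never used. *)
Definition Mprime (j : nat) : hom prodg j 1 :=
  match j with 1%N => Hom bracketP | k => brace_hom k m end.

End InducedStructure.

End Braces.

(* ------------------------------------------------------------------------ *)
(* F |-> S o F o (S^{(x)n})^-1.  By the Koszul rule, (S^{(x)n})^-1 maps
   S x_1 (x) ... (x) S x_n to (-1)^(sum_i (n - i) |x_i|) x_1 (x) ... (x) x_n. *)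
Section SigmaBar.
Variables (R : comPzRingType) (B : gmod R).

Definition sigma_bar_fun n d (f : hom B n d) (ds : 'I_n -> int)
    (xs : forall i, shift B (ds i)) : shift B (d + 1 - n%:Z + \sum_i ds i) :=
  ksign R (\sum_(i < n) (n - i.+1)%:Z * (ds i - 1)) *:
  hcomponent (A := B) (d + 1 - n%:Z + \sum_i ds i - 1)
    (mkh (f (fun i => ds i - 1) xs)).

Fact sigma_barP n d (f : hom B n d) : multilinear (A := shift B) (sigma_bar_fun f).
Proof.
move=> ds xs i; apply: (linear_scale_fun (V := B (ds i - 1))).
apply: (hcomponent_linear (A := B)).
by do 2!eexists; split; last by []; apply: (homP f (ds := fun i => ds i - 1)).
Qed.

Definition sigma_bar n d (f : hom B n d) : susp (End_operad (shift B)) n d :=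
  Hom (sigma_barP f).

Fact sigma_bar_linear n d : linear (@sigma_bar n d).
Proof.
move=> a f g; apply: hom_ext => ds xs.
suff lS : linear (fun f : hom B n d => sigma_bar_fun f xs) by exact: lS.
apply: linear_scale_fun; apply: (hcomponent_linear (A := B)).
by do 2!eexists; split; last by [].
Qed.

Definition sigma_bar_prod d (f : prodg (End_operad B) d)
    : prodg (susp (End_operad (shift B))) d := fun n => sigma_bar (f n).

Fact sigma_bar_prod_linear d : linear (@sigma_bar_prod d).
Proof.
move=> a f g; apply: functional_extensionality_dep => n.
exact: sigma_bar_linear.
Qed.

HB.instance Definition _ d :=
  GRing.isLinear.Build R _ _ _ (@sigma_bar_prod d) (@sigma_bar_prod_linear d).

End SigmaBar.

(* ------------------------------------------------------------------------ *)
Section PhiPrime.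
Variables (R : comPzRingType) (P : operad_data R).

Definition Phi' d (x : prodg P d) : prodg (End_operad (prodg P)) d :=
  fun n => brace_hom n x.

Fact Phi'_linear d : linear (@Phi' d).
Proof.
move=> a x y; apply: functional_extensionality_dep => n.
by apply: hom_ext => ds xs; apply: brace_linearl.
Qed.

HB.instance Definition _ d := GRing.isLinear.Build R _ _ _ (@Phi' d) (@Phi'_linear d).

End PhiPrime.

(* ------------------------------------------------------------------------ *)
(* A family of operations m_j : A^{(x)j} -> A of degree 2 - j; only the members
   with j >= 1 are meaningful. *)
Definition ainf_ops (R : comPzRingType) (A : gmod R) :=
  forall j : nat, hom A j (2 - j%:Z).

(* Strict morphisms: Phi o m_j = m'_j o Phi^{(x)j}; no signs since Phi has
   degree 0. *)
Definition ainf_morphism (R : comPzRingType) (A B : gmod R)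
    (mA : ainf_ops A) (mB : ainf_ops B) (Phi : gmap A B) : Prop :=
  forall j : nat, (1 <= j)%N -> forall (ds : 'I_j -> int) (xs : forall i, A (ds i)),
    Phi _ (mA j ds xs) = mB j ds (fun i => Phi (ds i) (xs i)).

(* An element of natural degree 1 of the suspension, concentrated in positive
   arity, with m o~ m = 0. *)
Definition ainf_multiplication (R : comPzRingType) (O : operad R)
    (m : prodg (susp O) 1) : Prop := m 0%N = 0 /\ circ m m = 0.

Definition Mops (R : comPzRingType) (P : operad_data R) (m : prodg P 1)
    : ainf_ops (shift (prodg P)) := fun j => sigma_bar (Mprime m j).

Section MainObjects.
Variables (R : comPzRingType) (O : operad R).

Definition SsO : gmod R := shift (prodg (susp O)).
Definition sEnd : operad_data R := susp (End_operad SsO).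
Definition SsEnd : gmod R := shift (prodg sEnd).

Definition Phi : gmap SsO SsEnd :=
  fun d => (@sigma_bar_prod R (prodg (susp O)) (d - 1)) \o (@Phi' R (susp O) (d - 1)).

Variable m : prodg (susp O) 1.

Definition M : ainf_ops SsO := Mops m.

(* M_1 + M_2 + ...; the degree 2 - j operation M_j has natural degree 1. *)
Definition Mtotal : prodg sEnd 1 := fun j => if j is 0%N then 0 else M j.

Definition Mbar : ainf_ops SsEnd := Mops Mtotal.

End MainObjects.

(* Main.v *)
From mathcomp Require Import all_boot all_order all_algebra.
From mathcomp Require Import boolp.
From mathcomp Require Import ring zify.
Require Import Defs.

(** After the shifts and the operad map sigma_bar are peeled off, the claim is
    that Phi' intertwines the operations M'_j of the operad P = susp O with the
    operations which M' = M'_1 + M'_2 + ... induces on End of [prodg P].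

    The heart is that Phi' preserves braces ([Phi'_brace]):
      Phi'(b_n(x; x_1, ..., x_n)) = B_n(Phi' x; Phi' x_1, ..., Phi' x_n).
    Evaluated on y_1, ..., y_k, both sides are the same signed sum.  Its terms
    are the words made, in order, of some of the y_j themselves and of the
    elements b(x_i; consecutive y_j), every x_i and every y_j being used once;
    such a word w contributes b(x; w), and its sign is the Koszul sign of moving
    the y_j past the x_i that come after them in w.  For the left hand side this
    is the pre-Jacobi identity ([pre_jacobi]): in (x; xs) with ys inserted
    afterwards, each y_j lands either in an input of x or in an input of some
    x_i, and the sequential and parallel axioms of an operad bring the
    composite to the form of b(x; w).  For the right hand side it is what
    composition of multilinear maps means ([hom_app_brace]).

    For j > 1 this settles the matter, since M'_k is b_k(m; -) for k > 1 and
    only words of length at least j occur.  For j = 1, M' differs from Phi' m by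
    an element K ([right_op]) which is m in arity 0, y |-> (-1)^|y| b_1(y; m) in
    arity 1, and 0 in higher arities.  The contributions of K to the two terms
    of the bracket of M' with Phi' x cancel because
      B_1(K; Phi' x) = (-1)^|x| B_1(Phi' x; K)
    ([right_op_commute]), which is the pre-Jacobi identity for
    b_1(b(x; ys); m): the element m is inserted next to the ys or into one of
    them.  Finally sigma_bar preserves partial compositions and the unit, with
    the signs of the operadic suspension ([sigma_cell_comp]), hence it
    preserves braces ([sigma_bar_brace]).

    Arities and degrees of composites agree only propositionally, so the
    calculations take place on elements packed with their indices, on which
    the operad laws are plain equations ([cell_laws]).  Elements of [prodg P]
    are infinite families; a fixed component of a brace only involves finitely
    many of their members, which is expressed by truncating every family at a
    large arity L ([brace_ins_sum], [hbrace_ins_sum_linear]). *)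

Set Implicit Arguments.
Unset Strict Implicit.
Unset Printing Implicit Defensive.

Import GRing.Theory.
Local Open Scope ring_scope.

(** * Linear functions and parity of signs *)

Section LinearFunctions.
Variables (R : comPzRingType) (V W : lmodType R) (f : V -> W).
Hypothesis lf : linear f.

Lemma linear_funD u v : f (u + v) = f u + f v.
Proof. by have := lf 1 u v; rewrite !scale1r. Qed.

Lemma linear_fun0 : f 0 = 0.
Proof. by apply: (addrI (f 0)); rewrite -linear_funD !addr0. Qed.

Lemma linear_funZ a u : f (a *: u) = a *: f u.
Proof. by have := lf a u 0; rewrite !addr0 linear_fun0 addr0. Qed.

Lemma linear_fun_sum n (F : 'I_n -> V) : f (\sum_(j < n) F j) = \sum_(j < n) f (F j).
Proof. exact: (big_morph f linear_funD linear_fun0). Qed.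

End LinearFunctions.

Lemma scale_linear (R : comPzRingType) (V : lmodType R) (a : R) :
  linear (fun u : V => a *: u).
Proof. by move=> b u v; rewrite scalerDr !scalerA mulrC. Qed.

Definition oddz (d : int) : bool := odd `|d|%N.

Lemma oddzD a b : oddz (a + b) = oddz a (+) oddz b.
Proof. by rewrite /oddz; case: a b => [a|a] [b|b]; lia. Qed.
Lemma oddzN a : oddz (- a) = oddz a.
Proof. by rewrite /oddz abszN. Qed.
Lemma oddzM a b : oddz (a * b) = oddz a && oddz b.
Proof. by rewrite /oddz abszM oddM. Qed.
Lemma oddz1 : oddz 1 = true. Proof. by []. Qed.
Lemma oddz0 : oddz 0 = false. Proof. by []. Qed.

Section Sign.
Variable R : comPzRingType.

Lemma ksign_odd d : ksign R d = (-1) ^+ oddz d.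
Proof. by rewrite /ksign signr_odd. Qed.

Lemma ksign_eq a b : oddz a = oddz b -> ksign R a = ksign R b.
Proof. by rewrite !ksign_odd => ->. Qed.

Lemma ksignD a b : ksign R (a + b) = ksign R a * ksign R b.
Proof. by rewrite !ksign_odd oddzD signr_addb. Qed.

Lemma ksign0 : ksign R 0 = 1.
Proof. by []. Qed.

End Sign.

(** A sign only depends on the parity of its exponent, so an identity between
    signs is a boolean identity in the parities of the degrees and arities. *)
Ltac parity :=
  rewrite ?(oddzD, oddzN, oddzM, oddz1, oddz0);
  repeat match goal with |- context [oddz ?a] => generalize (oddz a) end;
  clear; repeat (case || move=> _); reflexivity.

(** * Homogeneous elements packed with their degree *)

Section Packed.
Variables (R : comPzRingType).

Section Tag.
Variables (I : eqType) (F : I -> lmodType R).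
Let T := {i : I & F i}.

Lemma untag_id i (u : T) (e : tag u = i) :
  existT (fun j => F j : Type) i (untag (T_ := fun j => F j : Type) (i := i) 0 id u) = u.
Proof.
case: u e => j x /= e; subst i.
by rewrite (untagE _ _ (erefl : tag (existT _ j x) = j)).
Qed.

End Tag.

Section Hel.
Variable A : gmod R.
Implicit Types h u v : hel A.

Lemma hcomponentE d (x : A d) : hcomponent d (mkh x) = x.
Proof. by rewrite /hcomponent (untagE _ _ (erefl : tag (mkh x) = d)). Qed.

Lemma mkh_hcomponent d h : tag h = d -> mkh (hcomponent d h) = h.
Proof. exact: (@untag_id _ A). Qed.

Lemma hcomponent0 d h : tag h != d -> hcomponent d h = 0.
Proof. exact: untag_dflt. Qed.

Lemma mkh_inj d : injective (@mkh R A d).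
Proof. by move=> x y /(congr1 (hcomponent d)); rewrite !hcomponentE. Qed.

Lemma hcomponent_mkh0 d d' : hcomponent d (mkh (0 : A d')) = 0.
Proof.
have [e|ne] := eqVneq d' d; first by subst d'; rewrite hcomponentE.
by rewrite hcomponent0.
Qed.

Lemma mkhE h : mkh (tagged h) = h.
Proof. by case: h. Qed.

(** Equality of elements whose degrees agree only propositionally. *)
Lemma hel_eq h h' : tag h = tag h' ->
  (forall e, hcomponent e h = hcomponent e h') -> h = h'.
Proof. by move=> th hh; rewrite -[h](mkh_hcomponent th) hh mkh_hcomponent. Qed.

Definition scaleh (a : R) h : hel A := mkh (a *: tagged h).

Lemma hcomponentZ a d h : hcomponent d (scaleh a h) = a *: hcomponent d h.
Proof.
have [e|ne] := eqVneq (tag h) d; last by rewrite !hcomponent0 // scaler0.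
by case: h e => e x /= e'; subst e; rewrite /scaleh !hcomponentE.
Qed.

Lemma scaleh_mkhc a d h : tag h = d -> mkh (a *: hcomponent d h) = scaleh a h.
Proof. by case: h => e x /= <-; rewrite hcomponentE. Qed.

Lemma scalehA a b h : scaleh a (scaleh b h) = scaleh (a * b) h.
Proof. by rewrite /scaleh scalerA. Qed.

Lemma scaleh1 h : scaleh 1 h = h.
Proof. by rewrite /scaleh scale1r mkhE. Qed.

Definition hdeg (s : seq (hel A)) : int := \sum_(h <- s) tag h.

Lemma hdeg_nil : hdeg [::] = 0. Proof. exact: big_nil. Qed.
Lemma hdeg_cons h s : hdeg (h :: s) = tag h + hdeg s.
Proof. exact: big_cons. Qed.
Lemma hdeg_cat s t : hdeg (s ++ t) = hdeg s + hdeg t.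
Proof. exact: big_cat. Qed.

Lemma hdeg_nth n s : size s = n ->
  hdeg s = \sum_(i < n) tag (nth (mkh (0 : A 0)) s i).
Proof. by move=> <-; rewrite /hdeg (big_nth (mkh (0 : A 0))) big_mkord. Qed.

Lemma size_hels n ds (xs : forall i : 'I_n, A (ds i)) : size (hels xs) = n.
Proof. by rewrite size_map size_enum_ord. Qed.

Lemma nth_hels n ds (xs : forall i : 'I_n, A (ds i)) z (i : 'I_n) :
  nth z (hels xs) i = mkh (xs i).
Proof. by rewrite (nth_map i) ?size_enum_ord // nth_ord_enum. Qed.

Lemma hels1 ds (xs : forall i : 'I_1, A (ds i)) : hels xs = [:: mkh (xs ord0)].
Proof. by rewrite /hels enum_ordSl /= (size0nil (s := enum 'I_0)) ?size_enum_ord. Qed.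

Lemma hdeg_hels n ds (xs : forall i : 'I_n, A (ds i)) :
  hdeg (hels xs) = \sum_i ds i.
Proof. by rewrite /hdeg /hels big_map big_enum. Qed.

Lemma hom_app_hels n d (f : hom A n d) ds (xs : forall i, A (ds i)) :
  hom_app f (hels xs) = mkh (f ds xs).
Proof.
pose K (y : 'I_n -> hel A) := mkh (f (fun j => tag (y j)) (fun j => tagged (y j))).
rewrite -[RHS]/(K (fun j => mkh (xs j))).
rewrite -[LHS]/(K (fun j => nth (mkh (0 : A 0)) (hels xs) j)).
by congr K; apply: functional_extensionality_dep => j; rewrite nth_hels.
Qed.

Lemma tag_hom_app n d (f : hom A n d) s : size s = n ->
  tag (hom_app f s) = d + hdeg s.
Proof. by move=> sn; rewrite (hdeg_nth sn). Qed.

Lemma hels_nth s :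
  hels (fun j : 'I_(size s) => tagged (nth (mkh (0 : A 0)) s j)) = s.
Proof.
apply: (@eq_from_nth _ (mkh (0 : A 0))); first by rewrite size_hels.
move=> i; rewrite size_hels => si.
by rewrite (nth_hels _ _ (Ordinal si)) mkhE.
Qed.

Lemma hom_app_inj n d (f g : hom A n d) :
  (forall s, size s = n -> hom_app f s = hom_app g s) -> f = g.
Proof.
move=> fg; apply: hom_ext => ds xs; apply: mkh_inj.
by rewrite -!hom_app_hels fg // size_hels.
Qed.

(** Linearity in one argument survives packing because scaling does not change
    the degree. *)
Lemma hom_app_scale n d (f : hom A n d) s1 h s2 a : (size s1 < n)%N ->
  hom_app f (s1 ++ scaleh a h :: s2) = scaleh a (hom_app f (s1 ++ h :: s2)).
Proof.
move=> s1n; case: h => e x.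
have mkl : tlinear (F := A) (fun u : A e => mkh u) by exists e, id.
have [d' [phi [lphi GE]]] := hom_app_tlinear f s2 s1n mkl.
apply: (etrans (GE (a *: x))).
apply: (etrans (congr1 (@mkh R A d') (linear_funZ lphi a x))).
exact: (esym (congr1 (scaleh a) (GE x))).
Qed.

End Hel.
End Packed.

(** * Operad laws for cells *)

Section CellTheory.
Variables (R : comPzRingType) (P : operad_data R).
Implicit Types c x y z : cell P.

Definition cdeg c : int := (tag c).2.

Lemma componentE n d (x : P n d) : component n d (mkc x) = x.
Proof. by rewrite /component (untagE _ _ (erefl : tag (mkc x) = (n, d))). Qed.

Lemma mkc_component n d c : arity c = n -> cdeg c = d -> mkc (component n d c) = c.
Proof. by case: c => -[n' d'] x /= <- <-; rewrite componentE. Qed.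

Lemma component0 n d c : (arity c != n) || (cdeg c != d) -> component n d c = 0.
Proof.
move=> ne; apply: untag_dflt; move: ne; rewrite /arity /cdeg; case: (tag c) => n' d' /=.
by rewrite xpair_eqE negb_and.
Qed.

Definition scalec (a : R) c : cell P :=
  mkc (n := (tag c).1) (d := (tag c).2) (a *: tagged c).

Lemma scalecA a b c : scalec a (scalec b c) = scalec (a * b) c.
Proof. by case: c => -[n d] x; rewrite /scalec /= scalerA. Qed.

Lemma scalec1 c : scalec 1 c = c.
Proof. by case: c => -[n d] x; rewrite /scalec /= scale1r. Qed.

Lemma cell_comp_in c i y (h : (i < arity c)%N) :
  cell_comp c i y = mkc (ocomp (tagged c) (Ordinal h : 'I_(arity c)) (tagged y)).
Proof. by rewrite /cell_comp insubT. Qed.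

Lemma arity_comp c i y : (i < arity c)%N ->
  arity (cell_comp c i y) = (arity c + arity y).-1.
Proof. by move=> h; rewrite cell_comp_in. Qed.

Lemma cdeg_comp c i y : (i < arity c)%N ->
  cdeg (cell_comp c i y) = cdeg c + cdeg y.
Proof. by move=> h; rewrite cell_comp_in. Qed.

Lemma cell_compZl a c i y : cell_comp (scalec a c) i y = scalec a (cell_comp c i y).
Proof.
case: c => -[n d] x; rewrite /cell_comp /scalec /arity /=; case: insub => [j|] /=.
  by rewrite (linear_funZ (@ocomp_linl _ P n _ d _ j (tagged y))).
by rewrite scaler0.
Qed.

Lemma cell_compZr a c i y : cell_comp c i (scalec a y) = scalec a (cell_comp c i y).
Proof.
case: y => -[n d] y; rewrite /cell_comp /scalec /arity /=; case: insub => [j|] /=.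
  by rewrite (linear_funZ (@ocomp_linr _ P _ n _ d (tagged c) j)).
by rewrite scaler0.
Qed.

(** On packed elements the axioms need no transports.  Both positions in the
    parallel axiom refer to inputs of x; composing with y at the smaller one
    shifts the larger one. *)
Record cell_laws : Prop := CellLaws {
  comp_seq : forall x y z i j, (i < arity x)%N -> (j < arity y)%N ->
    cell_comp (cell_comp x i y) (i + j) z = cell_comp x i (cell_comp y j z);
  comp_par : forall x y z i k, (i < k)%N -> (k < arity x)%N ->
    cell_comp (cell_comp x i y) (k + arity y).-1 z =
    scalec (ksign R (cdeg y * cdeg z)) (cell_comp (cell_comp x k z) i y);
  comp_unit : forall x i, (i < arity x)%N -> cell_comp x i (mkc (ounit P)) = x }.

Lemma operad_cell_laws : operad_axioms P -> cell_laws.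
Proof.
case=> aseq apar _ aunit; split.
- move=> [[n p] x] [[m q] y] [[l r] z] i j /= hi hj.
  have hk : (i + j < (n + m).-1)%N by rewrite /arity /= in hi hj *; lia.
  rewrite (cell_comp_in _ hi) (cell_comp_in _ hj) /= (cell_comp_in (c := mkc _) _ hk).
  by rewrite (cell_comp_in _ hi) /=; apply: aseq.
- move=> [[n p] x] [[m q] y] [[l r] z] i k ik /= hk.
  have hi : (i < n)%N by apply: ltn_trans hk.
  have hk' : ((k + m).-1 < (n + m).-1)%N by rewrite /arity /= in hk *; lia.
  have hi' : (i < (n + l).-1)%N by rewrite /arity /= in hk *; lia.
  rewrite (cell_comp_in (c := existT _ (n, p) x) _ hi) (cell_comp_in _ hk) /=.
  rewrite (cell_comp_in (c := mkc _) _ hk') (cell_comp_in (c := mkc _) _ hi') /scalec /=.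
  exact: apar.
- move=> [[n p] x] i hi; rewrite (cell_comp_in _ hi) /=; exact: aunit.
Qed.

End CellTheory.

(** * Operadic suspension *)

Section SuspLaws.
Variables (R : comPzRingType) (O : operad_data R).

(** The cell of O underlying a cell of the suspension; the degree changes from
    natural to internal. *)
Definition desusp (c : cell (susp O)) : cell O :=
  mkc (n := arity c) (d := cdeg c + 1 - (arity c)%:Z) (tagged c).

Lemma desusp_inj : injective desusp.
Proof.
move=> [[n d] x] [[n' d'] y] /= E.
have En : n = n' by have := congr1 (@arity _ _) E.
subst n'.
have Ed : d = d'.
  have := congr1 (@cdeg _ _) E; rewrite /cdeg /arity /= => /eqP.
  by rewrite -!addrA => /eqP /addIr.
subst d'; congr existT.
by have := congr1 (component n (d + 1 - n%:Z)) E; rewrite !componentE.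
Qed.

Lemma cdeg_desusp c : cdeg (desusp c) = cdeg c + 1 - (arity c)%:Z.
Proof. by []. Qed.

Lemma desuspZ a c : desusp (scalec a c) = scalec a (desusp c).
Proof. by case: c => -[n d] x. Qed.

Lemma desusp_comp c i y : (i < arity c)%N ->
  desusp (cell_comp c i y) =
  scalec (ksign R (((arity c)%:Z - 1) * cdeg y + i%:Z * ((arity y)%:Z - 1)))
    (cell_comp (desusp c) i (desusp y)).
Proof.
move=> hi; rewrite (cell_comp_in _ hi) (cell_comp_in (c := desusp c) _ hi).
case: c hi => -[n p] x; case: y => -[m q] y; rewrite /arity /cdeg /= => hi.
rewrite /desusp /arity /cdeg /= /susp_comp /= /scalec /=.
set f := ocomp _ _ _.
have E : p + q + 1 - (n + m).-1%:Z = (p + 1 - n%:Z) + (q + 1 - m%:Z) by lia.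
have -> : hcomponent (A := O (n + m).-1) (p + q + 1 - (n + m).-1%:Z) (mkh f)
   = component (n + m).-1 (p + q + 1 - (n + m).-1%:Z) (mkc f).
  rewrite E componentE.
  exact: (@hcomponentE _ (O (n + m).-1)).
rewrite -[LHS]/(scalec _ (mkc (component _ _ _))) mkc_component //.
by rewrite /scalec /=; congr (mkc (_ *: _)); apply: ksign_eq; parity.
Qed.

(** Natural degrees govern the Koszul signs of the suspension: the exponents
    (n-1) q + i (m-1) in the insertions turn the internal degrees of the
    parallel axiom into natural ones. *)
Lemma susp_cell_laws : cell_laws O -> cell_laws (susp O).
Proof.
case=> lseq lpar lunit; split.
- move=> x y z i j hi hj; apply: desusp_inj.
  have h1 : (i + j < arity (cell_comp x i y))%N by rewrite arity_comp //; lia.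
  rewrite !desusp_comp // !cell_compZl !cell_compZr !scalecA.
  rewrite -lseq //; congr (scalec _ _); rewrite -!ksignD; apply: ksign_eq.
  rewrite !arity_comp // cdeg_comp //.
  have -> : (arity x + arity y).-1%:Z = (arity x)%:Z + (arity y)%:Z - 1 by lia.
  have -> : (arity y + arity z).-1%:Z = (arity y)%:Z + (arity z)%:Z - 1 by lia.
  rewrite PoszD; parity.
- move=> x y z i k ik hk; apply: desusp_inj.
  have hi : (i < arity x)%N by lia.
  have h1 : ((k + arity y).-1 < arity (cell_comp x i y))%N by rewrite arity_comp //; lia.
  have h2 : (i < arity (cell_comp x k z))%N by rewrite arity_comp //; lia.
  rewrite desuspZ !desusp_comp // !cell_compZl !scalecA.
  rewrite lpar // !scalecA; congr (scalec _ _); rewrite -!ksignD; apply: ksign_eq.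
  rewrite !arity_comp //.
  have -> : (arity x + arity y).-1%:Z = (arity x)%:Z + (arity y)%:Z - 1 by lia.
  have -> : (arity x + arity z).-1%:Z = (arity x)%:Z + (arity z)%:Z - 1 by lia.
  have -> : (k + arity y).-1%:Z = k%:Z + (arity y)%:Z - 1 by lia.
  rewrite !cdeg_desusp; parity.
- move=> x i hi; apply: desusp_inj; rewrite desusp_comp //.
  have E : desusp (mkc (ounit (susp O))) = mkc (ounit O) by [].
  rewrite E lunit // /arity /cdeg /= (_ : _ + _ = 0) ?scalec1 //; ring.
Qed.

End SuspLaws.

(** * Evaluation of endomorphism cells *)

Section EndCells.
Variables (R : comPzRingType) (A : gmod R).
Local Notation E := (End_operad A).
Implicit Types (c f g : cell E) (s : seq (hel A)).

Definition cell_app c s : hel A := hom_app (tagged c : hom A (arity c) (cdeg c)) s.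

Lemma tag_scaleh a (h : hel A) : tag (scaleh a h) = tag h.
Proof. by []. Qed.

Lemma cell_app_scale a c s : cell_app (scalec a c) s = scaleh a (cell_app c s).
Proof. by case: c => -[n d] f. Qed.

Lemma tag_cell_app c s : size s = arity c -> tag (cell_app c s) = cdeg c + hdeg s.
Proof. exact: tag_hom_app. Qed.

Lemma end_cell_ext c c' : arity c = arity c' -> cdeg c = cdeg c' ->
  (forall s, size s = arity c -> cell_app c s = cell_app c' s) -> c = c'.
Proof.
case: c c' => -[n d] f [[n' d'] f']; rewrite /arity /cdeg /= => e e' fE.
by subst n' d'; congr existT; apply: hom_app_inj.
Qed.

Lemma hom_app_end_comp n m p q (f : hom A n p) (i : 'I_n) (g : hom A m q) s1 s2 s3 :
  size s1 = i -> size s2 = m -> (i + size s3).+1 = n ->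
  hom_app (end_comp f i g) (s1 ++ s2 ++ s3) =
  scaleh (ksign R (q * hdeg s1)) (hom_app f (s1 ++ hom_app g s2 :: s3)).
Proof.
move=> z1 z2 z3; set s := s1 ++ s2 ++ s3.
have zs : size s = (n + m).-1 by rewrite !size_cat; lia.
have hs : hels (fun j : 'I_(n + m).-1 => tagged (nth (mkh (0 : A 0)) s j)) = s.
  by case: _ / zs; apply: hels_nth.
rewrite -{1}hs hom_app_hels /= /end_comp_fun /= hs.
have -> : take i s = s1 by rewrite -z1 take_size_cat.
have -> : take m (drop i s) = s2 by rewrite -z1 drop_size_cat // -z2 take_size_cat.
have -> : drop (i + m) s = s3 by rewrite -z1 -z2 -size_cat /s catA drop_size_cat.
rewrite scaleh_mkhc; last first.
  rewrite tag_hom_app; last by rewrite size_cat /=; lia.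
  rewrite hdeg_cat hdeg_cons tag_hom_app // -(hdeg_nth zs) /s !hdeg_cat; ring.
congr (scaleh (ksign R (q * _)) _).
rewrite -(@big_ord_widen _ _ _ i (n + m).-1 (fun l => tag (nth (mkh (0 : A 0)) s l))).
  rewrite (hdeg_nth z1); apply: eq_bigr => j _.
  by rewrite /s nth_cat z1 ltn_ord.
by have := ltn_ord i; lia.
Qed.

Lemma cell_app_comp f g s1 s2 s3 :
  size s2 = arity g -> (size s1 + size s3).+1 = arity f ->
  cell_app (cell_comp f (size s1) g) (s1 ++ s2 ++ s3) =
  scaleh (ksign R (cdeg g * hdeg s1)) (cell_app f (s1 ++ cell_app g s2 :: s3)).
Proof.
move=> z2 z3; have h : (size s1 < arity f)%N by lia.
by rewrite (cell_comp_in _ h) /cell_app /= hom_app_end_comp.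
Qed.

Lemma cell_app_scale_in c s1 h s2 a : (size s1 < arity c)%N ->
  cell_app c (s1 ++ scaleh a h :: s2) = scaleh a (cell_app c (s1 ++ h :: s2)).
Proof. exact: hom_app_scale. Qed.

Lemma cell_app_unit h : cell_app (mkc (ounit E)) [:: h] = h.
Proof.
rewrite /cell_app /hom_app /= /end_unit_fun /= mkh_hcomponent ?mkhE //.
by rewrite big_ord1 add0r.
Qed.

(** Cells of the endomorphism operad are determined by their values, so the
    unit law is checked on arguments. *)
Lemma end_comp_unit c i : (i < arity c)%N -> cell_comp c i (mkc (ounit E)) = c.
Proof.
move=> h; apply: end_cell_ext; rewrite ?arity_comp ?cdeg_comp ?addr0 //=.
  by rewrite /arity /= addn1.
rewrite /arity addn1 /= -/(arity c) => s zs.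
have zi : size (take i s) = i by rewrite size_take zs h.
case E1: (drop i s) => [|y s3]; first by have := size_drop i s; rewrite E1 /=; lia.
have z3 : size s3 = (arity c - i.+1)%N by have := size_drop i s; rewrite E1 /=; lia.
have -> : s = take i s ++ [:: y] ++ s3 by rewrite /= -E1 cat_take_drop.
rewrite -{1}zi cell_app_comp //=; last by rewrite zi; lia.
by rewrite cell_app_unit mul0r ksign0 scaleh1.
Qed.

End EndCells.

(** * The operad map sigma_bar *)

Section SigmaCells.
Variables (R : comPzRingType) (B : gmod R).
Implicit Types (s : seq (hel (shift B))).

Definition unshift (h : hel (shift B)) : hel B := mkh (A := B) (d := tag h - 1) (tagged h).

Lemma unshift_inj : injective unshift.
Proof.
move=> [d x] [d' y] /= E.
have Ed : d = d' by have /= /addIr := congr1 (@tag _ _) E.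
by subst d'; congr existT; have := mkh_inj E.
Qed.

Lemma unshift_scale a h : unshift (scaleh a h) = scaleh a (unshift h).
Proof. by []. Qed.

(** The Koszul rule for the n-fold tensor power of the inverse shift: an
    argument of degree d is passed by the inverse shifts of all the arguments
    to its right. *)
Fixpoint unshift_sign (t : seq (hel B)) : int :=
  if t is h :: t' then (size t')%:Z * tag h + unshift_sign t' else 0.

Lemma unshift_sign_cons h t : unshift_sign (h :: t) = (size t)%:Z * tag h + unshift_sign t.
Proof. by []. Qed.

Lemma unshift_sign_cat t1 t2 : unshift_sign (t1 ++ t2) =
  unshift_sign t1 + (size t2)%:Z * hdeg t1 + unshift_sign t2.
Proof.
elim: t1 => [|h t IH] /=; first by rewrite hdeg_nil mulr0 !add0r.
by rewrite IH hdeg_cons size_cat PoszD; ring.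
Qed.

Lemma unshift_sign_nth z t :
  unshift_sign t = \sum_(i < size t) (size t - i.+1)%N%:Z * tag (nth z t i).
Proof.
elim: t => [|h t IH] /=; first by rewrite big_ord0.
by rewrite big_ord_recl /= subn1 /= IH.
Qed.

Lemma hdeg_unshift s : hdeg [seq unshift h | h <- s] = hdeg s - (size s)%:Z.
Proof.
elim: s => [|h s IH] /=; first by rewrite !hdeg_nil.
by rewrite !hdeg_cons IH /=; lia.
Qed.

Lemma sigma_bar_app n d (f : hom B n d) s : size s = n ->
  unshift (hom_app (sigma_bar f : hom (shift B) n (d + 1 - n%:Z)) s) =
  scaleh (ksign R (unshift_sign [seq unshift h | h <- s]))
    (hom_app f [seq unshift h | h <- s]).
Proof.
move=> zs; pose z : hel (shift B) := mkh (A := shift B) (d := 0) 0.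
pose z' : hel B := mkh (A := B) (d := 0) 0.
pose K (y : 'I_n -> hel B) := mkh (f (fun j => tag (y j)) (fun j => tagged (y j))).
have KE : mkh (f (fun i : 'I_n => tag (nth z s i) - 1) (fun i => tagged (nth z s i)))
   = hom_app f [seq unshift h | h <- s].
  rewrite -[LHS]/(K (fun j => unshift (nth z s j))).
  rewrite -[RHS]/(K (fun j => nth z' (map unshift s) j)).
  congr K; apply: functional_extensionality_dep => j.
  by rewrite (nth_map z) // zs.
rewrite /hom_app /= /sigma_bar_fun /= /unshift /=.
rewrite -/z KE.
rewrite (@scaleh_mkhc _ B); last first.
  rewrite tag_hom_app ?size_map // hdeg_unshift (hdeg_nth zs) -/z.
  by rewrite zs; ring.
congr (scaleh (ksign R _) _).
rewrite (unshift_sign_nth z') size_map zs; apply: eq_bigr => i _.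
by rewrite (nth_map z) // zs.
Qed.

Definition sigma_cell (c : cell (End_operad B)) : cell (susp (End_operad (shift B))) :=
  mkc (n := arity c) (d := cdeg c) (sigma_bar (tagged c : hom B (arity c) (cdeg c))).

Lemma unshift_cell_app_sigma_cell c s : size s = arity c ->
  unshift (cell_app (desusp (sigma_cell c)) s) =
  scaleh (ksign R (unshift_sign [seq unshift h | h <- s]))
    (cell_app c [seq unshift h | h <- s]).
Proof. exact: sigma_bar_app. Qed.

(** Compare the signs on an argument list s1 ++ s2 ++ s3 with s2 fed to g.
    Three sources appear on the right (suspension, Koszul sign of g moved past
    s1, inverse shifts inside and outside g); the coefficients of the degrees
    of s1, s2, s3 and the constant term agree modulo 2 with those on the
    left. *)
Lemma sigma_cell_comp f i g :
  sigma_cell (cell_comp f i g) = cell_comp (sigma_cell f) i (sigma_cell g).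
Proof.
have [hi|hi] := ltnP i (arity f); last first.
  (* outside the range both compositions are 0 in arity 0 and degree 0 *)
  have oE (P : operad_data R) (c : cell P) y : (arity c <= i)%N ->
      cell_comp c i y = mkc (0 : P 0 0).
    by move=> h; rewrite /cell_comp insubF // ltnNge h.
  rewrite !oE //.
  rewrite /sigma_cell /arity /cdeg /=; congr mkc.
  apply: hom_ext => ds xs; rewrite /= /sigma_bar_fun /=.
  by rewrite (@hcomponent_mkh0 _ B) scaler0.
apply: desusp_inj; rewrite (desusp_comp (c := sigma_cell f)) //.
apply: end_cell_ext.
- rewrite -[LHS]/(arity (cell_comp f i g)).
  rewrite -[RHS]/(arity (cell_comp (desusp (sigma_cell f)) i (desusp (sigma_cell g)))).
  by rewrite !arity_comp.
- rewrite -[LHS]/(cdeg (cell_comp f i g) + 1 - (arity (cell_comp f i g))%:Z).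
  rewrite -[RHS]/(cdeg (cell_comp (desusp (sigma_cell f)) i (desusp (sigma_cell g)))).
  rewrite !cdeg_comp // arity_comp //.
  rewrite -[cdeg (desusp (sigma_cell f))]/(cdeg f + 1 - (arity f)%:Z).
  rewrite -[cdeg (desusp (sigma_cell g))]/(cdeg g + 1 - (arity g)%:Z).
  by lia.
move=> s zs'; have {zs'} zs : size s = (arity f + arity g).-1.
  by rewrite zs' -[LHS]/(arity (cell_comp f i g)) arity_comp.
set m := arity g; set n := arity f in zs *.
pose s1 := take i s; pose s2 := take m (drop i s); pose s3 := drop m (drop i s).
have z1 : size s1 = i by rewrite size_take zs; case: ltnP => //; lia.
have z2 : size s2 = m.
  by rewrite size_take size_drop zs; case: ltnP => //; lia.
have z3 : (i + size s3).+1 = n by rewrite size_drop size_drop zs; lia.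
have sE : s = s1 ++ s2 ++ s3 by rewrite !cat_take_drop.
apply: unshift_inj; rewrite unshift_cell_app_sigma_cell; last by rewrite arity_comp.
rewrite cell_app_scale unshift_scale {1 3}sE -z1.
rewrite (cell_app_comp (f := desusp (sigma_cell f))) //; last by rewrite z1.
rewrite unshift_scale unshift_cell_app_sigma_cell; last by rewrite size_cat /= z1; lia.
rewrite !map_cat /= (unshift_cell_app_sigma_cell (c := g)) //.
rewrite cell_app_scale_in ?size_map; last by rewrite z1.
have -> : [seq unshift h | h <- s] =
    [seq unshift h | h <- s1] ++ [seq unshift h | h <- s2] ++ [seq unshift h | h <- s3].
  by rewrite -!map_cat -sE.
rewrite (_ : cell_comp f (size s1) g = cell_comp f (size [seq unshift h | h <- s1]) g);
  last by rewrite size_map.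
rewrite cell_app_comp ?size_map //; last by rewrite z1.
rewrite !scalehA -!ksignD; congr (scaleh _ _); apply: ksign_eq.
rewrite !unshift_sign_cat !unshift_sign_cons tag_scaleh tag_cell_app ?size_map //.
rewrite !size_cat [size (_ :: _)]/= !size_map !hdeg_unshift z1 z2.
have -> : cdeg (desusp (sigma_cell g)) = cdeg g + 1 - m%:Z by [].
have -> : cdeg (sigma_cell g) = cdeg g by [].
have -> : arity (sigma_cell g) = m by [].
have -> : arity (sigma_cell f) = n by [].
rewrite -z3 -[(_ + _).+1]addn1 -[(size s3).+1]addn1 !PoszD; parity.
Qed.

Lemma sigma_cell_unit :
  sigma_cell (mkc (ounit (End_operad B))) = mkc (ounit (susp (End_operad (shift B)))).
Proof.
apply: desusp_inj; apply: end_cell_ext => // -[//|h [|//]] _.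
apply: unshift_inj.
by rewrite unshift_cell_app_sigma_cell // !cell_app_unit /= mul0r addr0 scaleh1.
Qed.

Lemma component_sigma_cell n d c :
  component n d (sigma_cell c) = sigma_bar (component n d c : hom B n d).
Proof.
have [e|ne] := boolP ((arity c == n) && (cdeg c == d)).
  case: c e => -[n' d'] f /= /andP[/eqP/= <- /eqP/= <-].
  by rewrite /sigma_cell /arity /cdeg /= !componentE.
rewrite negb_and in ne; rewrite !component0 //.
exact: (esym (linear_fun0 (@sigma_bar_linear _ B n d))).
Qed.

End SigmaCells.

(** * Sums over insertions *)

Section Insert.
Variables (R : comPzRingType) (P : operad_data R).
Local Notation A := (prodg P).
Implicit Types (c u v x z : cell P) (ys zs : seq (hel A)).

Definition letter (y : hel A) (a : nat) : cell P := mkc ((tagged y : prodg P (tag y)) a).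

Lemma arity_letter y a : arity (letter y a) = a. Proof. by []. Qed.
Lemma cdeg_letter y a : cdeg (letter y a) = tag y. Proof. by []. Qed.

Section InsertionSum.
Variable L : nat.

(** The sum over the order preserving insertions of all of ys into the k inputs
    of c starting at position i, as a recursion on the inputs: an input is left
    alone (a unit is inserted) or receives the next element of ys.  Elements of
    ys are products over arities; only their arities below L are inserted.  The
    continuation H gets the resulting cell together with the position reached,
    which makes it possible to go on inserting from there. *)
Fixpoint ins_sum (V : lmodType R) (i k : nat) c ys (H : nat -> cell P -> V) : V :=
  match k with
  | 0 => if ys is [::] then H i c else 0
  | k'.+1 => ins_sum i.+1 k' c ys H +
      (if ys is y :: ys' then
         \sum_(a < L) ins_sum (i + a) k' (cell_comp c i (letter y a)) ys' H
       else 0)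
  end.

Section FixedTarget.
Variable V : lmodType R.
Implicit Type H : nat -> cell P -> V.

(** The invariants of an insertion: how position, arity and degree evolve. *)
Lemma ins_sum_ext i k c ys H H' : (i + k <= arity c)%N ->
  (forall q v, (i <= q)%N -> (arity v + (i + k) = arity c + q)%N ->
     (arity c <= arity v + size ys)%N -> cdeg v = cdeg c + hdeg ys -> H q v = H' q v) ->
  ins_sum i k c ys H = ins_sum i k c ys H'.
Proof.
elim: k i c ys => [|k IH] i c ys hk HH' /=.
  case: ys HH' => // HH'; apply: HH'; rewrite ?hdeg_nil ?addr0 //; lia.
congr (_ + _).
  apply: IH => [|q v]; first lia.
  by move=> h1 h2 h3 h4; apply: HH' => //; lia.
case: ys HH' => // y ys HH'; apply: eq_bigr => a _.
have hi : (i < arity c)%N by lia.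
apply: IH => [|q v]; rewrite arity_comp // arity_letter; first by lia.
rewrite cdeg_comp // cdeg_letter => h1 h2 h3 h4.
by apply: HH'; rewrite /= ?hdeg_cons ?addrA //; lia.
Qed.

Lemma ins_sum_eq i k c ys H H' : (forall q v, H q v = H' q v) ->
  ins_sum i k c ys H = ins_sum i k c ys H'.
Proof.
move=> HH'; congr ins_sum; apply: functional_extensionality_dep => q.
by apply: functional_extensionality_dep => v.
Qed.

Lemma ins_sum0 i k c ys : ins_sum i k c ys (fun _ _ => 0 : V) = 0.
Proof.
elim: k i c ys => [|k IH] i c [|y ys] //=; rewrite IH add0r //.
by apply: big1 => a _; apply: IH.
Qed.

Lemma ins_sumD i k c ys H H' :
  ins_sum i k c ys (fun q v => H q v + H' q v) = ins_sum i k c ys H + ins_sum i k c ys H'.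
Proof.
elim: k i c ys => [|k IH] i c [|y ys] //=; rewrite ?addr0 // IH //.
by rewrite addrACA -big_split /=; congr (_ + _); apply: eq_bigr => a _; rewrite IH.
Qed.

Lemma ins_sum_sum n i k c ys (H : 'I_n -> nat -> cell P -> V) :
  ins_sum i k c ys (fun q v => \sum_(j < n) H j q v) = \sum_(j < n) ins_sum i k c ys (H j).
Proof.
elim: n H => [|n IH] H.
  rewrite big_ord0; apply: etrans (ins_sum0 i k c ys); apply: ins_sum_eq => q v.
  by rewrite big_ord0.
rewrite big_ord_recl -IH -ins_sumD; apply: ins_sum_eq => q v.
by rewrite big_ord_recl.
Qed.

(** Linearity on each homogeneous component; cells of different tags cannot be
    added. *)
Definition cell_linear (h : cell P -> V) := forall n d, linear (fun u : P n d => h (mkc u)).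

Lemma cell_linearZ h a c : cell_linear h -> h (scalec a c) = a *: h c.
Proof.
move=> lh; case: c => -[n d] x.
by rewrite -[LHS]/((fun u : P n d => h (mkc u)) (a *: x)) linear_funZ.
Qed.

Lemma cell_linear_comp (U : lmodType R) h (G : U -> cell P) : cell_linear h ->
  tlinear (F := fun nd => P nd.1 nd.2) G -> linear (fun w => h (G w)).
Proof.
move=> lh [[n d] [phi [lphi GE]]] a u v; rewrite !GE lphi; exact: lh.
Qed.

Lemma mkc_tlinear n d : tlinear (F := fun nd => P nd.1 nd.2) (fun u : P n d => mkc u).
Proof. by exists (n, d), id. Qed.

Lemma ins_sum_tlinear (U : lmodType R) (G : U -> cell P) i k ys H :
  (forall q, cell_linear (H q)) -> tlinear (F := fun nd => P nd.1 nd.2) G ->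
  linear (fun w => ins_sum i k (G w) ys H).
Proof.
move=> lH; elim: k i G ys => [|k IH] i G ys lG /=.
  by case: ys => [|y ys]; [apply: cell_linear_comp | apply: linear0_fun].
apply: linear_add_fun; first exact: IH.
case: ys => [|y ys]; first exact: linear0_fun.
apply: linear_sum_fun => a; apply: (IH _ (fun w => cell_comp (G w) _ _)).
exact: cell_comp_tlinearl.
Qed.

Lemma ins_sum_cell_linear i k ys H :
  (forall q, cell_linear (H q)) -> cell_linear (fun c => ins_sum i k c ys H).
Proof. by move=> lH n d; apply: ins_sum_tlinear => //; apply: mkc_tlinear. Qed.

(** Inserting one element lowers the arity by at most one, so insertions into a
    cell of large arity never reach small arities. *)
Lemma ins_sum_vanish M i k c ys H :
  (forall q v, (M <= arity v)%N -> H q v = 0) ->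
  (i + k <= arity c)%N -> (M + size ys <= arity c)%N -> ins_sum i k c ys H = 0.
Proof.
move=> H0 hk hM; apply: etrans (ins_sum0 i k c ys); apply: ins_sum_ext => // q v _ _ h _.
by apply: H0; lia.
Qed.

(** Some initial segment of ys goes into the first a inputs, and the rest of ys
    goes into the remaining k inputs. *)
Lemma ins_sum_split i a k u ys H :
  ins_sum i (a + k) u ys H = \sum_(b < (size ys).+1)
    ins_sum i a u (take b ys) (fun q v => ins_sum q k v (drop b ys) H).
Proof.
elim: a i u ys => [|a IH] i u ys.
  rewrite big_ord_recl take0 drop0 /= big1 ?addr0 // => b _.
  by case: ys b => [|y ys] b //; case: b.
rewrite addSn /= IH big_split /=; congr (_ + _).
case: ys => [|y ys]; first by rewrite big_ord_recl big_ord0 /= addr0.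
rewrite [RHS]big_ord_recl /= add0r exchange_big /=.
by apply: eq_bigr => e _; rewrite IH; apply: eq_bigr.
Qed.

Section Laws.
Hypothesis lawP : cell_laws P.

(** Composing with z to the left of the inserted elements can be done before
    them, by the parallel axiom applied once per element. *)
Lemma ins_sum_par j k c xs p z h : (p < j)%N -> (j + k = arity c)%N -> cell_linear h ->
  ins_sum j k c xs (fun _ u => h (cell_comp u p z)) =
  ksign R (cdeg z * hdeg xs) *:
    ins_sum (j + arity z).-1 k (cell_comp c p z) xs (fun _ u => h u).
Proof.
move=> pj hk lh; elim: k j c xs pj hk => [|k IH] j c xs pj hk /=.
  by case: xs => [|x xs]; rewrite ?scaler0 // hdeg_nil mulr0 ksign0 scale1r.
have E : (j.+1 + arity z).-1 = (j + arity z).-1.+1 by lia.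
rewrite IH ?E //; [|lia|lia]; rewrite scalerDr; congr (_ + _).
case: xs => [|x xs]; first by rewrite scaler0.
rewrite scaler_sumr; apply: eq_bigr => a _.
rewrite IH; [|lia|rewrite arity_comp ?arity_letter; lia].
rewrite (comp_par lawP) //; [|lia].
rewrite (@cell_linearZ (fun c => ins_sum _ k c xs _)); last first.
  by apply: ins_sum_cell_linear.
rewrite scalerA hdeg_cons cdeg_letter -ksignD.
have -> : (j + a + arity z).-1 = ((j + arity z).-1 + a)%N by lia.
by congr (_ *: _); apply: ksign_eq; parity.
Qed.

(** Inserting into those inputs of a composite that come from the inner cell is
    inserting into the inner cell, by the sequential axiom. *)
Lemma ins_sum_in i j k c y ys H : (i < arity c)%N -> (j + k = arity y)%N ->
  ins_sum (i + j) k (cell_comp c i y) ys H =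
  ins_sum j k y ys (fun q t => H (i + q)%N (cell_comp c i t)).
Proof.
move=> hi; elim: k j y ys => [|k IH] j y ys hk //=.
rewrite -addnS IH //; [|lia]; congr (_ + _).
case: ys => // e ys; apply: eq_bigr => a _.
by rewrite (comp_seq lawP) -?addnA ?IH ?arity_comp ?arity_letter //; lia.
Qed.

(** Insertions of xs into the last inputs and of zs into the inputs just before
    them commute, at the cost of moving zs past xs. *)
Lemma ins_sum_swap p a j k c xs zs H : (p + a = j)%N -> (j + k = arity c)%N ->
  (forall q, cell_linear (H q)) ->
  ins_sum j k c xs (fun _ u => ins_sum p a u zs H) =
  ksign R (hdeg zs * hdeg xs) *:
    ins_sum p a c zs (fun q v => ins_sum q k v xs (fun _ u => H q u)).
Proof.
move=> pa hk lH; elim: a p j c zs pa hk => [|a IH] p j c zs pa hk /=.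
  case: zs => [|z zs]; last by rewrite ins_sum0 scaler0.
  by rewrite hdeg_nil mul0r ksign0 scale1r -pa addn0.
rewrite ins_sumD IH //; [|lia]; rewrite scalerDr; congr (_ + _).
case: zs => [|z zs]; first by rewrite ins_sum0 scaler0.
rewrite ins_sum_sum scaler_sumr; apply: eq_bigr => b _.
rewrite (ins_sum_par _ _ (h := fun v => ins_sum (p + b) a v zs H)) //;
  [|lia|exact: ins_sum_cell_linear].
rewrite arity_letter (IH (p + b)%N); [|lia|rewrite arity_comp ?arity_letter; lia].
rewrite scalerA hdeg_cons cdeg_letter -ksignD; congr (_ *: _); apply: ksign_eq; parity.
Qed.

End Laws.
End FixedTarget.

Lemma ins_sum_map (V W : lmodType R) (phi : V -> W) i k c ys (H : nat -> cell P -> V) :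
  linear phi -> phi (ins_sum i k c ys H) = ins_sum i k c ys (fun q v => phi (H q v)).
Proof.
move=> lphi; have phi0 := linear_fun0 lphi; have phiD := linear_funD lphi.
elim: k i c ys => [|k IH] i c [|y ys] //=; rewrite phiD IH ?phi0 //; congr (_ + _).
by rewrite (linear_fun_sum lphi); apply: eq_bigr => a _; apply: IH.
Qed.

End InsertionSum.

(** The truncation arity is irrelevant once it exceeds what the continuation
    can see. *)
Lemma ins_sum_widen (V : lmodType R) L0 L M i k c ys (H : nat -> cell P -> V) :
  (forall q v, (M <= arity v)%N -> H q v = 0) ->
  (i + k <= arity c)%N -> (M + size ys <= L0)%N -> (L0 <= L)%N ->
  ins_sum L i k c ys H = ins_sum L0 i k c ys H.
Proof.
move=> H0; elim: k i c ys => [|k IH] i c ys hk hM hL //=.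
congr (_ + _); first by apply: IH => //; lia.
case: ys hM => // y ys /= hM.
have hi : (i < arity c)%N by lia.
have hk' a : (i + a + k <= arity (cell_comp c i (letter y a)))%N.
  by rewrite arity_comp ?arity_letter //; lia.
rewrite (big_ord_widen_cond L xpredT
  (fun a => ins_sum L0 (i + a) k (cell_comp c i (letter y a)) ys H)) //.
rewrite [RHS]big_mkcond; apply: eq_bigr => a _ /=; case: ltnP => ha.
  by apply: IH => //; lia.
by apply: ins_sum_vanish H0 _ _; rewrite arity_comp ?arity_letter //; lia.
Qed.

End Insert.

(** * Sums over interleavings *)

Section Interleave.
Variables (R : comPzRingType) (A : gmod R).
Local Notation G := (hel (prodg (End_operad A))).
Implicit Types (gs : seq G) (ys w : seq (hel A)).

Definition happ (g : G) (s : seq (hel A)) : hel A :=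
  hom_app ((tagged g : prodg (End_operad A) (tag g)) (size s) : hom A (size s) (tag g)) s.

Lemma tag_happ g s : tag (happ g s) = tag g + hdeg s.
Proof. exact: tag_hom_app. Qed.

(** The signed sum of H over the words obtained by consuming ys from left to
    right, each letter being the next element of ys or the next operation of gs
    applied to the next b elements of ys (b may be 0).  The sign is that of
    moving every consumed element of ys past the operations that come after
    it. *)
Fixpoint ilv_sum (V : lmodType R) gs : seq (hel A) -> (seq (hel A) -> V) -> V :=
  match gs with
  | [::] => fun ys H => H ys
  | g :: gs' => fix inner ys H :=
      (if ys is y :: ys' then
         ksign R (tag y * hdeg (g :: gs')) *: inner ys' (fun w => H (y :: w))
       else 0)
      + \sum_(b < (size ys).+1) ksign R (hdeg (take b ys) * hdeg gs') *:
          ilv_sum gs' (drop b ys) (fun w => H (happ g (take b ys) :: w))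
  end.

Section FixedTarget.
Variable V : lmodType R.
Implicit Type H : seq (hel A) -> V.

Lemma ilv_sum_cons g gs ys H : ilv_sum (g :: gs) ys H =
  (if ys is y :: ys' then
     ksign R (tag y * hdeg (g :: gs)) *: ilv_sum (g :: gs) ys' (fun w => H (y :: w))
   else 0)
  + \sum_(b < (size ys).+1) ksign R (hdeg (take b ys) * hdeg gs) *:
      ilv_sum gs (drop b ys) (fun w => H (happ g (take b ys) :: w)).
Proof. by case: ys. Qed.

(** When the empty word does not count, the cases gs = [::] and gs = g :: gs'
    follow one recursion on the first letter of the word. *)
Lemma ilv_sum_rec gs ys H : H [::] = 0 -> ilv_sum gs ys H =
  (if ys is y :: ys' then
     ksign R (tag y * hdeg gs) *: ilv_sum gs ys' (fun w => H (y :: w))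
   else 0)
  + (if gs is g :: gs' then
       \sum_(b < (size ys).+1) ksign R (hdeg (take b ys) * hdeg gs') *:
         ilv_sum gs' (drop b ys) (fun w => H (happ g (take b ys) :: w))
     else 0).
Proof.
move=> H0; case: gs => [|g gs]; last exact: ilv_sum_cons.
case: ys => [|y ys] /=; first by rewrite addr0.
by rewrite hdeg_nil mulr0 ksign0 scale1r addr0.
Qed.

Lemma ilv_sum_ext gs ys H H' :
  (forall w, (size gs <= size w)%N -> (size w <= size gs + size ys)%N ->
     hdeg w = hdeg gs + hdeg ys -> H w = H' w) ->
  ilv_sum gs ys H = ilv_sum gs ys H'.
Proof.
elim: gs ys H H' => [|g gs IHg] ys H H'.
  by move=> HH'; apply: HH'; rewrite // hdeg_nil add0r.
elim: ys H H' => [|y ys IHy] H H' HH';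
  rewrite ilv_sum_cons [RHS]ilv_sum_cons; congr (_ + _).
- apply: eq_bigr => b _; congr (_ *: _); apply: IHg => w /= w1 w2 w3.
  by apply: HH' => //=; rewrite !hdeg_cons w3 tag_happ hdeg_nil; ring.
- congr (_ *: _); apply: IHy => w w1 w2 w3; apply: HH' => /=; first exact: leqW.
    by rewrite addnS.
  by rewrite !hdeg_cons w3 hdeg_cons; ring.
- apply: eq_bigr => b _; congr (_ *: _); apply: IHg => w w1 w2 w3.
  apply: HH' => //=.
    by move: w2; rewrite size_drop /=; lia.
  rewrite hdeg_cons w3 tag_happ -[in hdeg (y :: ys)](cat_take_drop b (y :: ys)) hdeg_cat.
  by rewrite hdeg_cons; ring.
Qed.

Lemma ilv_sum_eq gs ys H H' : (forall w, H w = H' w) -> ilv_sum gs ys H = ilv_sum gs ys H'.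
Proof. by move=> HH'; apply: ilv_sum_ext. Qed.

End FixedTarget.

Lemma ilv_sum_map (V W : lmodType R) (phi : V -> W) gs ys H :
  linear phi -> phi (ilv_sum gs ys H) = ilv_sum gs ys (fun w => phi (H w)).
Proof.
move=> lphi; have phi0 := linear_fun0 lphi; have phiD := linear_funD lphi.
have phiZ := linear_funZ lphi.
elim: gs ys H => [|g gs IHg] ys H //.
elim: ys H => [|y ys IHy] H; rewrite ilv_sum_cons [RHS]ilv_sum_cons;
  rewrite phiD ?phi0 ?phiZ ?IHy linear_fun_sum //; congr (_ + _).
  by apply: eq_bigr => b _; rewrite phiZ IHg.
by apply: eq_bigr => b _; rewrite phiZ IHg.
Qed.

Section LinearInH.
Variable V : lmodType R.
Implicit Type H : seq (hel A) -> V.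

Lemma ilv_sum0 gs ys : ilv_sum gs ys (fun _ => 0 : V) = 0.
Proof.
have l0 : linear (fun _ : V => 0 : V) by apply: linear0_fun.
by rewrite -(ilv_sum_map gs ys (fun=> 0) l0).
Qed.

Lemma ilv_sumD gs ys H H' :
  ilv_sum gs ys (fun w => H w + H' w) = ilv_sum gs ys H + ilv_sum gs ys H'.
Proof.
elim: gs ys H H' => [|g gs IHg] ys H H' //.
elim: ys H H' => [|y ys IHy] H H';
  rewrite ilv_sum_cons [ilv_sum _ _ H]ilv_sum_cons [ilv_sum _ _ H']ilv_sum_cons.
  by rewrite !add0r -big_split; apply: eq_bigr => b _; rewrite IHg scalerDr.
rewrite IHy scalerDr addrACA; congr (_ + _); rewrite -big_split.
by apply: eq_bigr => b _; rewrite IHg scalerDr.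
Qed.

Lemma ilv_sum_sum n gs ys (H : 'I_n -> seq (hel A) -> V) :
  ilv_sum gs ys (fun w => \sum_(j < n) H j w) = \sum_(j < n) ilv_sum gs ys (H j).
Proof.
elim: n H => [|n IH] H.
  rewrite big_ord0; apply: etrans (ilv_sum0 gs ys).
  by apply: ilv_sum_eq => w; rewrite big_ord0.
by rewrite big_ord_recl -IH -ilv_sumD; apply: ilv_sum_eq => w; rewrite big_ord_recl.
Qed.

Lemma ilv_sum_linear (U : lmodType R) gs ys (H : U -> seq (hel A) -> V) :
  (forall w, linear (fun u => H u w)) -> linear (fun u => ilv_sum gs ys (H u)).
Proof.
move=> lH a u v.
rewrite (ilv_sum_map gs ys (H u) (scale_linear a)) -ilv_sumD.
by apply: ilv_sum_eq => w; apply: lH.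
Qed.

End LinearInH.
End Interleave.

(** * Braces as insertion sums *)

Section BraceAsInsertions.
Variables (R : comPzRingType) (P : operad_data R).
Hypothesis unitP : forall (x : cell P) i, (i < arity x)%N ->
  cell_comp x i (mkc (ounit P)) = x.
Local Notation A := (prodg P).
Implicit Types (c x z : cell P) (ys zs : seq (hel A)).

Section LettersSum.
Variables (V : lmodType R) (L : nat).

(** The sum over finite functions in the definition of braces, in a form that
    allows induction on the list of arguments. *)
Fixpoint letters_sum ys (F : seq (cell P) -> V) : V :=
  if ys is y :: ys' then \sum_(a < L) letters_sum ys' (fun cs => F (letter y a :: cs))
  else F [::].

Lemma letters_sum_eq ys F F' : (forall cs, F cs = F' cs) ->
  letters_sum ys F = letters_sum ys F'.
Proof.
elim: ys F F' => [|y ys IH] F F' FF' //=.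
by apply: eq_bigr => a _; apply: IH => cs.
Qed.

Lemma letters_sum0 ys : letters_sum ys (fun=> 0) = 0.
Proof. by elim: ys => //= y ys IH; apply: big1. Qed.

Lemma letters_sumD ys F F' :
  letters_sum ys (fun cs => F cs + F' cs) = letters_sum ys F + letters_sum ys F'.
Proof.
elim: ys F F' => //= y ys IH F F'.
by rewrite -big_split; apply: eq_bigr => a _; rewrite IH.
Qed.

Lemma sum_ffunS n (F : {ffun 'I_n.+1 -> 'I_L} -> V) :
  \sum_l F l = \sum_(a < L) \sum_(l : {ffun 'I_n -> 'I_L})
     F [ffun i => if unlift ord0 i is Some j then l j else a].
Proof.
rewrite pair_big /=.
rewrite (reindex (fun p : 'I_L * {ffun 'I_n -> 'I_L} =>
  [ffun i => if unlift ord0 i is Some j then p.2 j else p.1])) //.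
exists (fun l : {ffun 'I_n.+1 -> 'I_L} => (l ord0, [ffun j => l (lift ord0 j)])).
  move=> [a l] _ /=; rewrite ffunE unlift_none; congr pair.
  by apply/ffunP => j; rewrite !ffunE liftK.
move=> l _; apply/ffunP => i; rewrite !ffunE /=.
by case: unliftP => [j ->|->]; rewrite ?ffunE.
Qed.

Lemma sum_ffun_letters_sum n (ds : 'I_n -> int) (xs : forall i, A (ds i)) F :
  \sum_(l : {ffun 'I_n -> 'I_L}) F [seq mkc (xs i (l i)) | i <- enum 'I_n] =
  letters_sum (hels xs) F.
Proof.
elim: n ds xs F => [|n IH] ds xs F.
  have -> : enum 'I_0 = [::] by apply: size0nil; rewrite size_enum_ord.
  rewrite /hels (_ : enum 'I_0 = [::]) /=; last by apply: size0nil; rewrite size_enum_ord.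
  by rewrite sumr_const card_ffun !card_ord expn0.
rewrite /hels enum_ordSl /= sum_ffunS; apply: eq_bigr => a _.
rewrite -map_comp -[X in letters_sum X]/(hels (fun i => xs (lift ord0 i))) -IH.
apply: eq_bigr => l _; rewrite ffunE unlift_none -map_comp; congr (F (_ :: _)).
by apply: eq_map => i /=; rewrite ffunE liftK.
Qed.

Lemma letters_sum_insertions i k c ys (h : cell P -> V) : (i + k <= arity c)%N ->
  letters_sum ys (fun cs => \sum_(s <- insertions k cs) h (gamma_from i c s)) =
  ins_sum L i k c ys (fun _ v => h v).
Proof.
elim: k i c ys => [|k IH] i c ys hk.
  case: ys => [|y ys] /=; first by rewrite big_seq1.
  apply: big1 => a _; apply: etrans (letters_sum0 ys); apply: letters_sum_eq => cs.
  by rewrite big_nil.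
have hi : (i < arity c)%N by lia.
have unitE s : gamma_from i c (mkc (ounit P) :: s) = gamma_from i.+1 c s.
  by rewrite /= unitP // addn1.
case: ys => [|y ys] /=.
  rewrite addr0 -IH /=; last by lia.
  by rewrite big_map; apply: eq_bigr => s _; apply: congr1 (unitE s).
rewrite -(IH i.+1 c (y :: ys)) /=; last by lia.
rewrite -big_split; apply: eq_bigr => a _ /=.
rewrite -IH; last by rewrite arity_comp // arity_letter; lia.
rewrite -letters_sumD; apply: letters_sum_eq => cs.
rewrite big_cat !big_map /=; congr (_ + _).
by apply: eq_bigr => s _; apply: congr1 (unitE s).
Qed.

End LettersSum.

(** The arity condition under the sum in the definition of braces is
    automatic, because the other arities do not contribute to the component. *)
Lemma brace_cell0 N D c (cs : seq (cell P)) :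
  (arity c + \sum_(y <- cs) arity y != N + size cs)%N -> brace_cell N D c cs = 0.
Proof.
move=> ne; rewrite /brace_cell big_seq; apply: big1 => s sin.
have /allP/(_ s sin)/and3P[/eqP s1 /eqP s2 _] := insertions_all (arity c) cs.
apply: component0; apply/orP; left; apply: contra ne.
rewrite /arity gamma_from_tag ?s1 // => /eqP /= <-.
by rewrite -s2.
Qed.

Lemma component_cell_linear N D : cell_linear (component N D : cell P -> P N D).
Proof. by move=> n d; apply: component_linear; apply: mkc_tlinear. Qed.

Lemma component_vanish N D c : (N < arity c)%N -> component N D c = 0 :> P N D.
Proof. by move=> h; apply: component0; rewrite neq_ltn h orbT. Qed.

(** Components of arity beyond N + n cannot contribute in arity N when n
    elements are inserted, so any larger truncation L computes the brace. *)
Lemma brace_ins_sum L N n d (x : A d) (ds : 'I_n -> int) (xs : forall i, A (ds i)) :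
  (N + n < L)%N ->
  brace x xs N = \sum_(a < L) ins_sum L 0 a (mkc (x a)) (hels xs)
                   (fun _ v => component N (d + \sum_i ds i) v).
Proof.
move=> hL; set D := d + _.
have sz := size_hels xs.
have van (q : nat) (v : cell P) : (N.+1 <= arity v)%N -> component N D v = 0 :> P N D.
  exact: component_vanish.
transitivity (\sum_(a < (N + n).+1) ins_sum (N + n).+1 0 a (mkc (x a)) (hels xs)
     (fun _ v => component N D v)).
  apply: eq_bigr => k _.
  rewrite -letters_sum_insertions // -sum_ffun_letters_sum big_mkcond.
  apply: eq_bigr => l _; case: ifPn => // ne.
  apply: esym; rewrite -[LHS]/(brace_cell N D (mkc (x k)) _); apply: brace_cell0.
  by rewrite big_map big_enum size_map size_enum_ord.
rewrite (big_ord_widen_cond L xpredT (fun a => ins_sum (N + n).+1 0 a (mkc (x a)) (hels xs)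
     (fun _ v => component N D v))) // big_mkcond; apply: eq_bigr => a _ /=.
case: ltnP => ha.
  by apply: esym; apply: (ins_sum_widen (M := N.+1)) => //; rewrite sz.
by apply: esym; apply: ins_sum_vanish van _ _ => //; rewrite sz /arity /=; lia.
Qed.

Definition hPhi (x : hel A) : hel (prodg (End_operad A)) :=
  mkh (A := prodg (End_operad A)) (Phi' (tagged x)).
Definition hbrace (x : hel A) (s : seq (hel A)) : hel A := happ (hPhi x) s.

Lemma tag_hbrace (x : hel A) s : tag (hbrace x s) = tag x + hdeg s.
Proof. exact: tag_happ. Qed.

Lemma hdeg_hPhi ys : hdeg [seq hPhi y | y <- ys] = hdeg ys.
Proof. by rewrite /hdeg big_map. Qed.

(** An insertion sum into the components of X may be replaced by the components
    of the brace of X, under any continuation K that is linear and ignores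
    large arities.  This lets a brace occur as a letter of another brace. *)
Lemma hbrace_ins_sum_linear L M (V : lmodType R) X zs (K : cell P -> V) :
  cell_linear K -> (forall t, (M <= arity t)%N -> K t = 0) -> (M + size zs <= L)%N ->
  \sum_(a < L) ins_sum L 0 a (letter X a) zs (fun _ t => K t) =
  \sum_(a < L) K (letter (hbrace X zs) a).
Proof.
move=> lK K0 hL; set D := tag (hbrace X zs).
have DE : D = tag X + hdeg zs by rewrite /D tag_hbrace.
have KE t : cdeg t = D -> K t = \sum_(N < M) K (mkc (component N D t)).
  move=> td; have K00 n d : K (mkc (0 : P n d)) = 0 := linear_fun0 (lK n d).
  have [ht|ht] := ltnP (arity t) M; last first.
    rewrite K0 // big1 // => N _; rewrite component0 ?K00 //.
    by apply/orP; left; rewrite neq_ltn (leq_trans (ltn_ord N) ht) orbT.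
  rewrite (bigD1 (Ordinal ht)) //= mkc_component // big1 ?addr0 // => N ne.
  rewrite component0 ?K00 //; apply/orP; left; apply: contra ne => /eqP e.
  by apply/eqP; apply: val_inj.
transitivity (\sum_(a < L) \sum_(N < M)
    ins_sum L 0 a (letter X a) zs (fun _ t => K (mkc (component N D t)))).
  apply: eq_bigr => a _; rewrite -ins_sum_sum; apply: ins_sum_ext => // q v _ _ _ vd.
  by apply: KE; rewrite vd DE.
rewrite exchange_big /=.
have ML : (M <= L)%N by lia.
transitivity (\sum_(N < M) K (letter (hbrace X zs) N)).
  apply: eq_bigr => N _.
  have lKN := lK N D.
  transitivity (\sum_(a < L) (fun u : P N D => K (mkc u))
     (ins_sum L 0 a (letter X a) zs (fun _ t => component N D t))).
    by apply: eq_bigr => a _; rewrite (ins_sum_map _ _ _ _ _ _ lKN).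
  rewrite -(linear_fun_sum lKN); congr (K (mkc _)).
  have hN : (N + size zs < L)%N by have := ltn_ord N; lia.
  by rewrite [RHS](brace_ins_sum _ _ hN) hels_nth.
rewrite (big_ord_widen_cond L xpredT (fun a => K (letter (hbrace X zs) a))) // big_mkcond.
by apply: eq_bigr => a _ /=; case: ltnP => // ha; rewrite K0.
Qed.

Lemma hcomponent_letter (x : hel A) N D : hcomponent D x N = component N D (letter x N).
Proof.
have [e|ne] := eqVneq (tag x) D.
  by case: x e => e x /= <-; rewrite hcomponentE componentE.
by rewrite hcomponent0 // component0 // cdeg_letter ne orbT.
Qed.

(** Unlike [brace_ins_sum] this holds for every D: both sides vanish unless D
    is the degree of the brace. *)
Lemma hbrace_ins_sum L N D X zs : (N + size zs < L)%N ->
  hcomponent D (hbrace X zs) N =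
  \sum_(a < L) ins_sum L 0 a (letter X a) zs (fun _ t => component N D t).
Proof.
move=> hL; rewrite (@hbrace_ins_sum_linear L N.+1) //.
- have hN : (N < L)%N by lia.
  rewrite (bigD1 (Ordinal hN)) //= -hcomponent_letter big1 ?addr0 // => a ne.
  rewrite component0 //; apply/orP; left; apply: contra ne => /eqP e.
  by apply/eqP; apply: val_inj.
- exact: component_cell_linear.
- exact: component_vanish.
Qed.

End BraceAsInsertions.

(** * The pre-Jacobi identity *)

Section PreJacobi.
Variables (R : comPzRingType) (P : operad_data R).
Hypothesis lawP : cell_laws P.
Local Notation A := (prodg P).
Implicit Types (c : cell P) (xs ys zs : seq (hel A)).

Let unitP := comp_unit lawP.

Lemma ins_sum_arity_linear (V : lmodType R) L i ys (h : cell P -> V) : cell_linear h ->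
  cell_linear (fun u => ins_sum L i (arity u - i) u ys (fun _ v => h v)).
Proof.
move=> lh n d; apply: (@linear_ext _ _ _ (fun u : P n d =>
  ins_sum L i (n - i) (mkc u) ys (fun _ v => h v))) => //.
by apply: ins_sum_cell_linear.
Qed.

(** The pre-Jacobi identity for insertions from position i on, by induction on
    the number k of inputs left in c.  The input i of c either receives no x,
    and then at most one y, or it receives the first x, together with those
    elements of ys that are inserted into this x.  On the other side this is
    the alternative for the first letter of a word inserted into c. *)
Lemma ins_sum_nested (V : lmodType R) L M k i c xs ys (h : cell P -> V) :
  cell_linear h -> (forall v, (M <= arity v)%N -> h v = 0) ->
  (i + k = arity c)%N -> (M + size xs + size ys <= L)%N ->
  ins_sum L i k c xs (fun _ u => ins_sum L i (arity u - i) u ys (fun _ v => h v)) =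
  ilv_sum (map (@hPhi _ P) xs) ys (fun w => ins_sum L i k c w (fun _ v => h v)).
Proof.
move=> lh h0; elim: k i c xs ys => [|k IH] i c xs ys hk hL.
  case: xs hL => [|x xs] hL; last first.
    by apply: esym; apply: etrans (ilv_sum0 _ _ _); apply: ilv_sum_ext => -[|? ?].
  by rewrite /= (_ : (_ - _)%N = 0%N) //; lia.
have hi : (i < arity c)%N by lia.
pose tail w : V := if w is y :: w' then
  \sum_(a < L) ins_sum L (i + a) k (cell_comp c i (letter y a)) w' (fun _ v => h v) else 0.
rewrite [RHS](@ilv_sumD _ _ V _ _ (fun w => ins_sum L i.+1 k c w (fun _ v => h v)) tail).
rewrite -IH //; [|lia]; rewrite (@ilv_sum_rec _ _ V _ _ tail) // hdeg_hPhi addrA.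
congr (_ + _).
  (* input i receives no x: leave it alone, or let it receive the first y, which
     is pulled to the front past all of xs *)
  case: ys hL => [|y ys] hL.
    rewrite addr0; apply: ins_sum_ext; first by lia.
    move=> q v h1 h2 _ _; rewrite (_ : arity v - i = (arity v - i.+1).+1)%N; last by lia.
    by rewrite /= addr0.
  transitivity (ins_sum L i.+1 k c xs (fun _ u =>
      ins_sum L i.+1 (arity u - i.+1) u (y :: ys) (fun _ v => h v) +
      \sum_(b < L) ins_sum L (i + b) (arity (cell_comp u i (letter y b)) - (i + b))
         (cell_comp u i (letter y b)) ys (fun _ v => h v))).
    apply: ins_sum_ext; first by lia.
    move=> q v h1 h2 _ _; rewrite (_ : arity v - i = (arity v - i.+1).+1)%N; last by lia.
    rewrite /=; congr (_ + _); apply: eq_bigr => b _; congr ins_sum.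
    by rewrite arity_comp ?arity_letter; lia.
  rewrite ins_sumD; congr (_ + _).
  rewrite ins_sum_sum /tail /= ilv_sum_sum scaler_sumr; apply: eq_bigr => b _.
  rewrite (@ins_sum_par _ _ L V lawP _ _ _ _ _ (letter y b)
      (fun u => ins_sum L (i + b) (arity u - (i + b)) u ys (fun _ v => h v))) //;
    [|lia|exact: ins_sum_arity_linear].
  rewrite arity_letter cdeg_letter (_ : (i.+1 + b).-1 = i + b)%N; last by lia.
  by rewrite IH // ?arity_comp ?arity_letter //=; move: hL => /=; lia.
(* input i receives the first x: split ys after the elements that go into it *)
case: xs hL => // x xs hL; rewrite map_cons hdeg_hPhi /=.
transitivity (\sum_(a < L) \sum_(b < (size ys).+1)
   ins_sum L (i + a) k (cell_comp c i (letter x a)) xs (fun _ u =>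
     ins_sum L i a u (take b ys) (fun q v =>
       ins_sum L q (arity v - q) v (drop b ys) (fun _ v => h v)))).
  apply: eq_bigr => a _; rewrite -ins_sum_sum; apply: ins_sum_ext.
    by rewrite arity_comp ?arity_letter //; lia.
  move=> q u; rewrite arity_comp // arity_letter => h1 h2 _ _.
  have -> : (arity u - i = a + (arity u - (i + a)))%N by lia.
  rewrite ins_sum_split; apply: eq_bigr => b _; apply: ins_sum_ext; first by lia.
  by move=> q' v h3 h4 _ _; congr ins_sum; lia.
rewrite exchange_big; apply: eq_bigr => b _ /=.
have sb : (size (take b ys) + size (drop b ys) = size ys)%N.
  by rewrite -size_cat cat_take_drop.
(* the elements of ys inside x go in before the other xs; what is inserted at
   input i is then a brace of x *)
pose K t := ilv_sum (map (@hPhi _ P) xs) (drop b ys)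
  (fun w => ins_sum L (i + arity t) k (cell_comp c i t) w (fun _ v => h v)).
transitivity (\sum_(a < L) ksign R (hdeg (take b ys) * hdeg xs) *:
   ins_sum L 0 a (letter x a) (take b ys) (fun _ t => K t)).
  apply: eq_bigr => a _; rewrite (@ins_sum_swap _ _ L V lawP) //; last first.
    - by move=> q; apply: ins_sum_arity_linear.
    - by rewrite arity_comp // arity_letter; lia.
  congr (_ *: _).
  rewrite -{1}[i]addn0.
  transitivity (ins_sum L (i + 0) a (cell_comp c i (letter x a)) (take b ys)
     (fun q v => ilv_sum (map (@hPhi _ P) xs) (drop b ys)
                    (fun w => ins_sum L q k v w (fun _ v => h v)))).
    apply: ins_sum_ext => [|q v]; rewrite arity_comp // arity_letter; first by lia.
    move=> h1 h2 _ _; apply: IH; first by lia.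
    by move: hL => /=; lia.
  rewrite (@ins_sum_in _ _ L V lawP) //.
  apply: ins_sum_ext => [|q t]; rewrite arity_letter //.
  by move=> _ h2 _ _; rewrite /K (_ : arity t = q) //; lia.
rewrite -scaler_sumr; congr (_ *: _).
rewrite (@hbrace_ins_sum_linear _ _ unitP L (M + size xs + size (drop b ys))).
- rewrite /tail /= ilv_sum_sum; apply: eq_bigr => a _.
  by rewrite /K.
- move=> n d; apply: ilv_sum_linear => w.
  apply: (@linear_ext _ _ _ (fun u : P n d =>
    ins_sum L (i + n) k (cell_comp c i (mkc u)) w (fun _ v => h v))) => //.
  apply: (@ins_sum_tlinear _ _ L V _ (fun u : P n d => cell_comp c i (mkc u))) => //.
  by apply: cell_comp_tlinearr; apply: mkc_tlinear.
- move=> t ht; apply: etrans (ilv_sum0 _ _ _); apply: ilv_sum_ext => w _ hw _.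
  move: hw; rewrite size_map => hw.
  by apply: (@ins_sum_vanish _ _ _ _ M) => //; rewrite arity_comp //; lia.
- by move: hL => /=; lia.
Qed.

(** Two nested braces: each of the ys is inserted into x directly or into one of
    the xs. *)
Lemma pre_jacobi e (x : hel A) xs ys :
  hcomponent e (hbrace (hbrace x xs) ys) =
  ilv_sum (map (@hPhi _ P) xs) ys (fun w => hcomponent e (hbrace x w)).
Proof.
apply: functional_extensionality_dep => N.
pose L := (N.+1 + size xs + size ys).+1.
have evl : linear (fun y : A e => y N) by [].
rewrite [RHS](ilv_sum_map _ _ _ evl).
rewrite (@hbrace_ins_sum _ _ unitP L); last by rewrite /L; lia.
pose K t := ins_sum L 0 (arity t - 0) t ys (fun _ v => component N e v).
transitivity (\sum_(a < L) K (letter (hbrace x xs) a)).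
  by apply: eq_bigr => a _; rewrite /K subn0.
have lh : cell_linear (component N e : cell P -> P N e) by apply: component_cell_linear.
rewrite -(@hbrace_ins_sum_linear _ _ unitP L (N.+1 + size ys)); last first.
- by rewrite /L; lia.
- move=> t ht; apply: (@ins_sum_vanish _ _ _ _ N.+1); rewrite ?subn0 //.
  by move=> _ v; apply: component_vanish.
- exact: ins_sum_arity_linear.
transitivity (\sum_(a < L) ilv_sum (map (@hPhi _ P) xs) ys
   (fun w => ins_sum L 0 a (letter x a) w (fun _ v => component N e v))).
  apply: eq_bigr => a _; rewrite -(@ins_sum_nested _ L N.+1) //.
  by move=> v; apply: component_vanish.
rewrite -ilv_sum_sum; apply: ilv_sum_ext => w _ hw _.
rewrite -(@hbrace_ins_sum _ _ unitP) //.
by move: hw; rewrite size_map /L; lia.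
Qed.

End PreJacobi.

(** * Braces of multilinear maps *)

Section EndBraces.
Variables (R : comPzRingType) (A : gmod R).
Local Notation E := (End_operad A).
Local Notation G := (hel (prodg E)).
Implicit Types (f : cell E) (gs : seq G) (s ys pre : seq (hel A)).

Lemma cell_app_letter (g : G) s a : size s = a -> cell_app (letter g a) s = happ g s.
Proof. by move=> <-. Qed.

(** Composites with the elements of gs are evaluated from left to right; pre is
    the list of arguments already consumed, plainly or by a map of gs.  A
    composite is only evaluated when its arity is the number of arguments. *)
Lemma ins_sum_cell_app L e k f gs pre ys : (size pre + k = arity f)%N -> (size ys < L)%N ->
  ins_sum L (size pre) k f gs (fun _ c =>
    if arity c == size (pre ++ ys) then hcomponent e (cell_app c (pre ++ ys)) else 0) =
  ksign R (hdeg pre * hdeg gs) *: ilv_sum gs ys (fun w =>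
    if size w == k then hcomponent e (cell_app f (pre ++ w)) else 0).
Proof.
elim: k f gs pre ys => [|k IH] f gs pre ys hk hL.
  case: gs => [|g gs].
    rewrite /= hdeg_nil mulr0 ksign0 scale1r -hk size_cat eqn_add2l eq_sym.
    by case: ys hL => [|y ys] _.
  rewrite (_ : ilv_sum _ _ _ = 0) ?scaler0 //.
  by apply: etrans (ilv_sum0 _ _ _); apply: ilv_sum_ext => -[|? ?].
rewrite ilv_sum_rec // scalerDr /=; congr (_ + _).
  case: ys hL => [|y ys] hL.
    rewrite scaler0; apply: etrans (ins_sum0 _ _ _ _ _ _); apply: ins_sum_ext; first by lia.
    by move=> q v h1 h2 _ _; rewrite cats0; case: eqP => //; lia.
  have zp : size (rcons pre y) = (size pre).+1 by rewrite size_rcons.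
  rewrite -cat_rcons -zp IH; [|lia|by move: hL => /=; lia].
  rewrite scalerA -ksignD -cats1 hdeg_cat hdeg_cons hdeg_nil.
  congr (_ *: _); first by apply: ksign_eq; parity.
  by apply: ilv_sum_eq => w; rewrite -catA eqSS.
case: gs => [|g gs]; first by rewrite scaler0.
have hi : (size pre < arity f)%N by lia.
rewrite scaler_sumr.
rewrite (big_ord_widen_cond L xpredT (fun b => ksign R (hdeg pre * hdeg (g :: gs)) *:
  (ksign R (hdeg (take b ys) * hdeg gs) *: ilv_sum gs (drop b ys) (fun w =>
    if size (happ g (take b ys) :: w) == k.+1
    then hcomponent e (cell_app f (pre ++ happ g (take b ys) :: w)) else 0)))) //.
rewrite [RHS]big_mkcond; apply: eq_bigr => a _ /=; case: ltnP => ha; last first.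
  apply: etrans (ins_sum0 _ _ _ _ _ _); apply: ins_sum_ext.
    by rewrite arity_comp ?arity_letter //; lia.
  move=> q v; rewrite arity_comp // arity_letter => h1 h2 _ _.
  by rewrite size_cat; case: eqP => //; lia.
have za : size (take a ys) = a by rewrite size_takel.
have zp : size (pre ++ take a ys) = (size pre + a)%N by rewrite size_cat za.
have catE : pre ++ ys = (pre ++ take a ys) ++ drop a ys by rewrite -catA cat_take_drop.
rewrite catE -zp IH; last first.
- by rewrite size_drop; lia.
- by rewrite zp arity_comp // arity_letter; lia.
rewrite !(ilv_sum_map _ _ _ (scale_linear _)); apply: ilv_sum_ext => w _ _ _.
rewrite eqSS; case: eqP => [zw|_]; last by rewrite !scaler0.
rewrite -catA cell_app_comp ?za //; last by lia.
rewrite cell_app_letter // hcomponentZ !scalerA -!ksignD cdeg_letter.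
congr (_ *: _); apply: ksign_eq.
by rewrite hdeg_cat hdeg_cons; parity.
Qed.

(** Evaluating a brace of multilinear maps feeds consecutive arguments to the
    inserted maps and leaves the others in place, with the Koszul signs. *)
Lemma hom_app_brace e n j d (F : prodg E d) (ds : 'I_j -> int)
    (gs : forall i, prodg E (ds i)) s :
  size s = n ->
  hcomponent e (hom_app (brace F gs n : hom A n (d + \sum_i ds i)) s) =
  ilv_sum (hels gs) s (fun w => hcomponent e (happ (mkh F) w)).
Proof.
move=> sn; pose L := (n + j).+1; set D := d + _.
have zg : size (hels gs) = j by apply: size_hels.
have lphi : linear (fun u : E n D => hcomponent e (hom_app (u : hom A n D) s)).
  by apply: hcomponent_linear; apply: hom_app_linl.
rewrite (@brace_ins_sum _ _ (@end_comp_unit _ A) L) //.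
rewrite (linear_fun_sum lphi).
transitivity (\sum_(a < L) ilv_sum (hels gs) s (fun w =>
   if size w == a then hcomponent e (cell_app (mkc (F a : E a d)) w) else 0)).
  apply: eq_bigr => a _; rewrite (ins_sum_map _ _ _ _ _ _ lphi).
  have := @ins_sum_cell_app L e a (mkc (F a : E a d)) (hels gs) [::] s.
  rewrite hdeg_nil mul0r ksign0 scale1r /= => <- //; last by rewrite sn /L; lia.
  apply: ins_sum_ext => // q v _ _ _ vd; rewrite -/D.
  have {}vd : cdeg v = D by rewrite vd hdeg_hels.
  rewrite sn; case: eqP => [vn|ne].
    have <- : mkc (component n D v) = v by apply: mkc_component.
    by rewrite componentE.
  rewrite component0; last by apply/orP; left; apply/eqP.
  by rewrite -[hom_app _ _]/(mkh 0) hcomponent_mkh0.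
rewrite -ilv_sum_sum; apply: ilv_sum_ext => w _ hw _.
have hwL : (size w < L)%N by move: hw; rewrite zg sn /L; lia.
rewrite (bigD1 (Ordinal hwL)) //= eqxx big1 ?addr0 // => a ne.
case: eqP => // e'; case/eqP: ne; apply: val_inj; exact: esym.
Qed.

End EndBraces.

(** * Compatibility with braces *)

Section SigmaBrace.
Variables (R : comPzRingType) (B : gmod R).
Local Notation E := (End_operad B).
Local Notation sE := (susp (End_operad (shift B))).

Lemma sigma_cell_gamma i (c : cell E) cs :
  sigma_cell (gamma_from i c cs) = gamma_from i (sigma_cell c) (map (@sigma_cell R B) cs).
Proof. by elim: cs i c => //= y cs IH i c; rewrite IH sigma_cell_comp. Qed.

Lemma sigma_cell_insertions k (cs : seq (cell E)) :
  insertions k (map (@sigma_cell R B) cs) = map (map (@sigma_cell R B)) (insertions k cs).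
Proof.
elim: k cs => [|k IH] [|y cs] //=.
  by rewrite (IH [::]) -!map_comp; apply: eq_map => s /=; rewrite sigma_cell_unit.
rewrite (IH (y :: cs)) IH map_cat -!map_comp; congr (_ ++ _).
by apply: eq_map => s /=; rewrite sigma_cell_unit.
Qed.

Lemma sigma_bar0 n d : sigma_bar (0 : hom B n d) = 0.
Proof. exact: (linear_fun0 (@sigma_bar_linear _ B n d)). Qed.

Lemma sigma_barD n d (f g : hom B n d) : sigma_bar (f + g) = sigma_bar f + sigma_bar g.
Proof. exact: (linear_funD (@sigma_bar_linear _ B n d)). Qed.

Lemma sigma_bar_brace n d (F : prodg E d) (ds : 'I_n -> int)
    (gs : forall i, prodg E (ds i)) :
  sigma_bar_prod (brace F gs) =
  brace (sigma_bar_prod F) (fun i => sigma_bar_prod (gs i)).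
Proof.
apply: functional_extensionality_dep => N.
rewrite /sigma_bar_prod /brace.
have m0 := sigma_bar0 N (d + \sum_i ds i).
have mD := @sigma_barD N (d + \sum_i ds i).
rewrite (big_morph _ mD m0); apply: eq_bigr => k _.
rewrite (big_morph _ mD m0); apply: eq_bigr => l _.
rewrite /brace_cell (big_morph _ mD m0).
pose cs := [seq mkc (gs i (l i)) | i <- enum 'I_n].
transitivity (\sum_(s <- insertions (arity (mkc (F k))) (map (@sigma_cell R B) cs))
    component N (d + \sum_i ds i) (gamma (sigma_cell (mkc (F k))) s));
  last by rewrite -map_comp.
rewrite sigma_cell_insertions big_map; apply: eq_bigr => s _.
by rewrite -component_sigma_cell /gamma sigma_cell_gamma.
Qed.

End SigmaBrace.

Section PhiBrace.
Variables (R : comPzRingType) (P : operad_data R).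
Hypothesis lawP : cell_laws P.
Local Notation A := (prodg P).
Local Notation E := (End_operad A).

Lemma happ_size (B : gmod R) (g : hel (prodg (End_operad B))) n s : size s = n ->
  happ g s = hom_app ((tagged g : prodg (End_operad B) (tag g)) n : hom B n (tag g)) s.
Proof. by move=> <-. Qed.

Lemma happ_hels (B : gmod R) (g : hel (prodg (End_operad B))) n (ds : 'I_n -> int)
    (xs : forall i, B (ds i)) :
  happ g (hels xs) =
  mkh (((tagged g : prodg (End_operad B) (tag g)) n : hom B n (tag g)) ds xs).
Proof. by rewrite (happ_size _ (size_hels xs)) hom_app_hels. Qed.

Lemma hels_Phi' n (ds : 'I_n -> int) (xs : forall i, A (ds i)) :
  hels (A := prodg E) (fun i => Phi' (xs i)) = map (@hPhi _ P) (hels xs).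
Proof. by rewrite /hels -map_comp. Qed.

(** On arguments, both sides are the same sum over interleavings. *)
Lemma Phi'_brace n d (x : A d) (ds : 'I_n -> int) (xs : forall i, A (ds i)) :
  Phi' (brace x xs) = brace (Phi' x) (fun i => Phi' (xs i)).
Proof.
apply: functional_extensionality_dep => N; apply: hom_app_inj => s sN.
apply: hel_eq; first by rewrite !tag_hom_app.
move=> e; rewrite [RHS](hom_app_brace e (Phi' x) _ sN) hels_Phi'.
have := pre_jacobi lawP e (mkh x) (hels xs) s.
rewrite {1 2}/hbrace (happ_hels (hPhi (mkh x))) (happ_size _ sN) => ->.
by [].
Qed.

Lemma hbrace_nil (x : hel A) : hbrace x [::] = x.
Proof.
apply: hel_eq; first by rewrite tag_hbrace hdeg_nil addr0.
move=> e; apply: functional_extensionality_dep => N.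
rewrite (@hbrace_ins_sum _ _ (comp_unit lawP) N.+1) ?addn0 //.
have gnil (V : lmodType R) L i k c (H : cell P -> V) :
    ins_sum L i k c [::] (fun _ v => H v) = H c.
  by elim: k i c => //= k IH i c; rewrite IH addr0.
rewrite big_ord_recr /= gnil -hcomponent_letter big1 ?add0r // => a _.
rewrite gnil component0 // arity_letter; apply/orP; left.
by rewrite neq_ltn ltn_ord.
Qed.

Lemma ilv_sum_nil (V : lmodType R) xs (H : seq (hel A) -> V) :
  ilv_sum (map (@hPhi _ P) xs) [::] H = H xs.
Proof.
elim: xs H => //= x xs IH H.
by rewrite add0r big_ord1 hdeg_nil mul0r ksign0 scale1r IH -/(hbrace x [::]) hbrace_nil.
Qed.

(** The only word of length one uses the whole of ys inside the single
    operation. *)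
Lemma ilv_sum_single (V : lmodType R) (g : hel (prodg E)) ys (H : seq (hel A) -> V) :
  (forall w, (2 <= size w)%N -> H w = 0) -> ilv_sum [:: g] ys H = H [:: happ g ys].
Proof.
move=> H0; rewrite ilv_sum_cons.
rewrite [X in X + _](_ : _ = 0) ?add0r; last first.
  case: ys => // y ys; rewrite (_ : ilv_sum _ _ _ = 0) ?scaler0 //.
  by apply: etrans (ilv_sum0 _ _ _); apply: ilv_sum_ext => w hw _ _; apply: H0.
rewrite big_ord_recr big1 /=.
  by rewrite add0r hdeg_nil mulr0 ksign0 scale1r take_size drop_size.
move=> b _; rewrite H0 ?scaler0 //= size_drop; have := ltn_ord b.
by lia.
Qed.

(** * The correction in arity one *)

Section RightAction.
Variable m : A 1.
Let mu : hel A := mkh m.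

(** The element M' whose image under sigma_bar is [Mtotal]. *)
Definition Mprime_tot : prodg E 1 := fun j => if j is 0%N then 0 else Mprime m j.

(** The correction K acts by bracketing with m on the right ([right_op1]), and
    its arity 0 part is m itself ([right_op0]). *)
Definition right_op : prodg E 1 := Phi' m - Mprime_tot.
Let K : hel (prodg E) := mkh (A := prodg E) right_op.

Lemma right_op0 : happ K [::] = mu.
Proof.
rewrite -[RHS]hbrace_nil /hbrace /happ /= /K.
by rewrite -[right_op 0%N]/(brace_hom 0 m - 0) subr0.
Qed.

Lemma right_op1 z : happ K [:: z] = scaleh (ksign R (tag z)) (hbrace z [:: mu]).
Proof.
have -> : [:: z] = hels (n := 1) (ds := fun=> tag z) (fun=> tagged z).
  by rewrite hels1 mkhE.
rewrite happ_hels /=.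
have -> : [:: mu] = hels (n := 1) (ds := fun=> 1) (fun=> m) by rewrite hels1.
rewrite /hbrace happ_hels /bracket_fun subKr.
by rewrite scaleh_mkhc //= !big_ord1 addrC.
Qed.

Lemma right_op2 w : (2 <= size w)%N -> happ K w = scaleh 0 (happ K w).
Proof.
move=> hw; rewrite /scaleh scale0r -[LHS]mkhE; congr mkh.
rewrite /happ /=; case: w hw => [|y [|z w]] // _.
by rewrite /= subrr.
Qed.

(** Inserting m into a word ys means placing it between two letters or bracketing
    one letter with it.  The same words arise when K is interleaved with ys,
    where K takes no element or one element, and when the maps Phi' y, for y in
    ys, are interleaved with the single argument m.  The signs differ by that
    of moving m past all of ys. *)
Lemma ilv_sum_right_action (V : lmodType R) ys (H : seq (hel A) -> V) :
  (forall a u z v, H (u ++ scaleh a z :: v) = a *: H (u ++ z :: v)) ->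
  ilv_sum [:: K] ys H = ksign R (hdeg ys) *: ilv_sum (map (@hPhi _ P) ys) [:: mu] H.
Proof.
elim: ys H => [|y ys IH] H HZ.
  rewrite ilv_sum_cons add0r big_ord1 /= !hdeg_nil mulr0 ksign0 !scale1r.
  by rewrite right_op0.
rewrite ilv_sum_cons (IH (fun w => H (y :: w)));
  last by move=> a u z v; apply: (HZ a (y :: u)).
rewrite (ilv_sum_cons (hPhi y)) [ilv_sum (_ :: _) [::] _](ilv_sum_nil (y :: ys)).
have tP : tag (hPhi y) = tag y by [].
have tm : tag mu = 1 by [].
have tK : tag K = 1 by [].
rewrite !hdeg_cons hdeg_nil hdeg_hPhi tP tm tK; set t := tag y in tP *.
rewrite !big_ord_recl big_ord0 /= addr0 ilv_sum_nil.
rewrite !hdeg_nil !mulr0 mul0r ksign0 !scale1r.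
rewrite -/(hbrace y [::]) hbrace_nil -/(hbrace y _).
rewrite right_op0 take0 drop0 right_op1 (HZ _ [::]) -/t.
rewrite big1 ?addr0; last first.
  move=> b _; rewrite right_op2; last by case: ys {IH} b => [|? ?] // [].
  by rewrite (HZ _ [::]) scale0r scaler0.
rewrite !scalerDr !scalerA -!ksignD !hdeg_cons hdeg_nil tm.
rewrite [LHS]addrCA; congr (_ + (_ + _)).
- rewrite -[LHS]scale1r; congr (_ *: _); rewrite -(ksign0 R); apply: ksign_eq; parity.
- by congr (_ *: _); apply: ksign_eq; parity.
- by congr (_ *: _); apply: ksign_eq; parity.
Qed.

End RightAction.
End PhiBrace.

(** * The induced operations *)

Section InducedOperations.
Variables (R : comPzRingType) (P : operad_data R).
Hypothesis lawP : cell_laws P.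
Local Notation A := (prodg P).
Local Notation E := (End_operad A).
Variable m : A 1.

(** Degreewise maps are compatible with the transports between propositionally
    equal degrees. *)
Lemma hcomponent_map (B C : gmod R) (phi : forall d, B d -> C d) d d' (x : B d) :
  (forall e, phi e 0 = 0) ->
  phi d' (hcomponent d' (mkh x)) = hcomponent d' (mkh (phi d x)).
Proof.
move=> phi0; have [e|ne] := eqVneq d d'.
  by subst d'; rewrite !hcomponentE.
by rewrite !hcomponent0.
Qed.

Lemma Phi'0 d : Phi' (0 : A d) = 0.
Proof. exact: (linear0 (@Phi' R P d)). Qed.

Lemma brace_linear1 (Q : operad_data R) d d' (x : prodg Q d) :
  linear (fun u : prodg Q d' => brace x (fun _ : 'I_1 => u)).
Proof.
pose ds (_ : 'I_1) := d'; pose z (i : 'I_1) : prodg Q (ds i) := 0.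
apply: (@linear_ext _ _ _ (fun u : prodg Q d' => brace x (dfwith z (i := ord0) u))).
  move=> u; congr brace; apply: functional_extensionality_dep => i.
  by rewrite (ord1 i) dfwith_in.
exact: (@braceP _ _ _ _ x ds z ord0).
Qed.

Lemma happ_hPhi_scale (x : hel A) a u (z : hel A) v :
  happ (hPhi x) (u ++ scaleh a z :: v) = scaleh a (happ (hPhi x) (u ++ z :: v)).
Proof.
rewrite (@happ_size _ _ (hPhi x) (size (u ++ z :: v))); last by rewrite !size_cat.
rewrite hom_app_scale //.
by rewrite size_cat /= -addSnnS leq_addr.
Qed.

(** K commutes with Phi' x for the brace bracket.  Since K vanishes on words of
    length at least two, the left hand side is K applied to b(x; s), that is
    b_1(b(x; s); m) up to sign, and the pre-Jacobi identity expands it. *)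
Lemma right_op_commute n (ds : 'I_1 -> int) (xs : forall i, A (ds i)) s e : size s = n ->
  hcomponent e (hom_app (brace (right_op m) (fun i => Phi' (xs i)) n
                  : hom A n (1 + \sum_i ds i)) s) =
  ksign R (ds ord0) *:
    hcomponent e (hom_app (brace (Phi' (xs ord0)) (fun _ : 'I_1 => right_op m) n
                  : hom A n (ds ord0 + \sum_(i < 1) 1)) s).
Proof.
move=> sn; rewrite !(hom_app_brace e _ _ sn) hels_Phi'.
rewrite !hels1 [map _ _]/= ilv_sum_single; last first.
  by move=> w hw; rewrite (right_op2 m hw) hcomponentZ scale0r.
rewrite (right_op1 m) hcomponentZ -/(hbrace (mkh (xs ord0)) s) (pre_jacobi lawP).
rewrite (ilv_sum_right_action lawP m); last first.
  by move=> a u z v; rewrite (happ_hPhi_scale (mkh (xs ord0))) hcomponentZ.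
by rewrite scalerA -ksignD tag_hbrace.
Qed.

(** For j > 1 only words of length at least two occur, on which M' and Phi' m
    agree; for j = 1 the two corrections by K cancel. *)
Lemma Phi'_Mprime j (ds : 'I_j -> int) (xs : forall i, A (ds i)) : (0 < j)%N ->
  Phi' (Mprime m j ds xs) = Mprime (Mprime_tot m) j ds (fun i => Phi' (xs i)).
Proof.
case: j ds xs => // -[|j] ds xs _; last first.
  rewrite [LHS](Phi'_brace lawP); apply: functional_extensionality_dep => n.
  apply: hom_app_inj => s sn; apply: hel_eq; first by rewrite !tag_hom_app.
  move=> e; rewrite [LHS](hom_app_brace e _ _ sn) [RHS](hom_app_brace e _ _ sn).
  apply: ilv_sum_ext => w; rewrite size_hels.
  by case: w => [|y [|z w]].
rewrite -[Mprime m 1 ds xs]/(bracket_fun m xs).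
rewrite -[RHS]/(bracket_fun (Mprime_tot m) (fun i => Phi' (xs i))).
rewrite /bracket_fun linearB linearZ /=.
rewrite (@hcomponent_map _ _ (fun d (u : A d) => Phi' u) _ _ _ Phi'0).
rewrite !(Phi'_brace lawP).
(* replace Phi' m by Mprime_tot m plus its correction, which cancels *)
have mE : Phi' m = Mprime_tot m + right_op m by rewrite /right_op addrC subrK.
rewrite mE.
have lin : linear (fun F : prodg E 1 => brace F (fun i => Phi' (xs i))).
  by apply: brace_linearl.
rewrite (linear_funD lin) (linear_funD (brace_linear1 (d' := 1) (Phi' (xs ord0)))).
have tagE : ds ord0 + \sum_(i < 1) 1 = 1 + \sum_i ds i by rewrite !big_ord1 addrC.
have hD d d' (a b : prodg E d) : hcomponent d' (mkh (a + b)) =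
   hcomponent d' (mkh a) + hcomponent d' (mkh b) :> prodg E d'.
  have [ed|ne] := eqVneq d d'; first by subst d'; rewrite !hcomponentE.
  by rewrite !hcomponent0 ?addr0.
rewrite hD scalerDr opprD addrACA -[RHS]addr0; congr (_ + _); apply/eqP.
rewrite subr_eq0; apply/eqP.
apply: functional_extensionality_dep => n.
apply: hom_app_inj => s sn; apply: hel_eq; first by rewrite !tag_hom_app.
move=> e; rewrite [LHS](right_op_commute xs e sn).
rewrite -[RHS]/(hcomponent e (scaleh _ (hom_app
  (hcomponent (1 + \sum_i ds i)
     (mkh (brace (Phi' (xs ord0)) (fun _ : 'I_1 => right_op m))) n
     : hom A n _) s))) hcomponentZ.
by case: _ / tagE; rewrite hcomponentE.
Qed.

Lemma sigma_bar_Mprime (B : gmod R) (F : prodg (End_operad B) 1) j (ds : 'I_j -> int)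
    (gs : forall i, prodg (End_operad B) (ds i)) :
  sigma_bar_prod (Mprime F j ds gs) =
  Mprime (sigma_bar_prod F) j ds (fun i => sigma_bar_prod (gs i)).
Proof.
case: j ds gs => [|[|j]] ds gs; try exact: sigma_bar_brace.
rewrite -[Mprime F 1 ds gs]/(bracket_fun F gs).
rewrite -[RHS]/(bracket_fun (sigma_bar_prod F) (fun i => sigma_bar_prod (gs i))).
rewrite /bracket_fun linearB linearZ /=.
rewrite (@hcomponent_map _ _
  (fun d (u : prodg (End_operad B) d) => sigma_bar_prod u)) ?sigma_bar_brace //.
by move=> d; apply: linear0.
Qed.

End InducedOperations.

Theorem theoremA (R : comPzRingType) (O : operad R) (m : prodg (susp O) 1)
  (hm : ainf_multiplication m) :
  ainf_morphism (M m) (Mbar m) (Phi O).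
Proof.
move=> j j0 ds xs.
have lawP : cell_laws (susp O) by apply/susp_cell_laws/operad_cell_laws/operadP.
have MtE : Mtotal m = sigma_bar_prod (Mprime_tot m).
  apply: functional_extensionality_dep => -[|k] //.
  by rewrite /sigma_bar_prod /= sigma_bar0.
rewrite /Mbar MtE.
rewrite -[LHS]/(sigma_bar_prod (Phi' (_ *: _))) !linearZ /=.
congr (_ *: _).
pose f d (u : prodg (susp O) d) := sigma_bar_prod (Phi' u).
rewrite -[LHS]/(f _ _) hcomponent_map; last by move=> d; rewrite /f !linear0.
congr (hcomponent _ (mkh _)).
by rewrite /f (Phi'_Mprime lawP m _ j0) sigma_bar_Mprime.
Qed.
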